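(* There exist absolute constants $\mathsf{C},\mathsf{C}'>0$ such that the following holds. Let $d\ge1$ be an integer and let $M\in\mathrm{Herm}(d^2)$ satisfy $(x\otimes y)^\dagger M(x\otimes y)\ge0$ for all $(x,y)\in\mathbb{C}^d\times\mathbb{C}^d$. Then for every integer $\ell\ge\mathsf{C}'d$, $$h_{\mathrm{Sep}}(M)\;\le\;h_{\mathrm{DPS}_\ell}(M)\;\le\;\Bigl(1+\mathsf{C}\,\frac{d^2}{\ell^2}\Bigr)h_{\mathrm{Sep}}(M).$$
   Context: $\mathrm{Herm}(m)$ is the space of $m\times m$ Hermitian matrices. $\mathrm{Sep}(d)=\mathrm{conv}\{xx^\dagger\otimes yy^\dagger: x,y\in\mathbb{C}^d,\ \|x\|=\|y\|=1\}$, and $h_{\mathrm{Sep}}(M)=\max_{\rho\in\mathrm{Sep}(d)}\mathrm{Tr}[M\rho]$. $\mathrm{DPS}_\ell(d)$ is defined as follows: write $\mathcal{H}_A=\mathcal{H}_B=\mathbb{C}^d$ and let $\mathcal{H}_{B_1},\ldots,\mathcal{H}_{B_\ell}$ be copies of $\mathcal{H}_B$. A positive semidefinite $\rho$ on $\mathcal{H}_A\otimes\mathcal{H}_B$ with $\mathrm{Tr}\,\rho=1$ belongs to $\mathrm{DPS}_\ell(d)$ iff there is a positive semidefinite operator $\rho_{AB_{[\ell]}}$ on $\mathcal{H}_A\otimes\mathcal{H}_{B_1}\otimes\cdots\otimes\mathcal{H}_{B_\ell}$ such that: (1) its partial trace over $B_2,\ldots,B_\ell$ equals $\rho$; (2)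 $(I\otimes\Pi)\rho_{AB_{[\ell]}}(I\otimes\Pi)=\rho_{AB_{[\ell]}}$, where $\Pi$ is the orthogonal projector of $\mathcal{H}_B^{\otimes\ell}$ onto its symmetric subspace (vectors invariant under all permutations of the $\ell$ tensor factors); (3) for each $s=1,\ldots,\ell$, the partial transpose of $\rho_{AB_{[\ell]}}$ on the systems $B_1,\ldots,B_s$ is positive semidefinite. Finally $h_{\mathrm{DPS}_\ell}(M)=\max_{\rho\in\mathrm{DPS}_\ell(d)}\mathrm{Tr}[M\rho]$. *)

(* Defs.v *)
From HB Require Import structures.
From mathcomp Require Import all_boot all_order all_algebra all_fingroup.
From mathcomp Require Import boolp classical_sets reals.
From mathcomp Require Import complex mxtens.

Set Implicit Arguments.
Unset Strict Implicit.
Unset Printing Implicit Defensive.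

Import Order.TTheory GRing.Theory Num.Theory.

Local Open Scope ring_scope.
Local Open Scope classical_set_scope.
Local Open Scope sesquilinear_scope.

(* The real field is an arbitrary [R : realType] and the complex field is
   [R[i]].  On [R[i]], [0 <= z] means that z is real and nonnegative, and
   [M^t*] is the conjugate transpose. *)

Section Operators.
Variable R : realType.
Local Notation C := (R[i]).

Definition qform n (A : 'M[C]_n) (v : 'cV[C]_n) : C := (v^t* *m A *m v) 0 0.

Definition psd n (A : 'M[C]_n) : Prop :=
  A \is hermsymmx /\ forall v : 'cV[C]_n, 0 <= qform A v.

Definition norm2 n (x : 'cV[C]_n) : C := sqrtC (\sum_i `|x i 0| ^+ 2).

(* [x *t y] has type 'M_(d * d, 1 * 1), which is convertible to 'cV_(d * d). *)
Definition tensv d (x y : 'cV[C]_d) : 'cV[C]_(d * d) := x *t y.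

Definition block_positive d (M : 'M[C]_(d * d)) : Prop :=
  forall x y : 'cV[C]_d, 0 <= qform M (tensv x y).

Definition conv m n (S : set 'M[C]_(m, n)) : set 'M[C]_(m, n) :=
  [set A | exists (k : nat) (p : 'I_k -> R) (B : 'I_k -> 'M[C]_(m, n)),
     [/\ forall i, 0 <= p i, \sum_i p i = 1, forall i, S (B i)
       & A = \sum_i (p i)%:C%C *: B i]].

Definition Sep (d : nat) : set 'M[C]_(d * d) :=
  conv [set A | exists x y : 'cV[C]_d,
     [/\ norm2 x = 1, norm2 y = 1 & A = (x *m x^t*) *t (y *m y^t*)]].

(* Support function of a set of states.  The real part only changes the type
   from [R[i]] to [R]: the trace of a product of two Hermitian matrices is
   real.  On the nonempty compact sets used below the supremum is a maximum. *)
Definition supportfun n (S : set 'M[C]_n) (M : 'M[C]_n) : R :=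
  sup [set complex.Re (\tr (M *m rho)) | rho in S].

Definition hSep d (M : 'M[C]_(d * d)) : R := supportfun (@Sep d) M.

Section Extensions.
Variables d l : nat.

(* The basis of (C^d)^{(x) l} is indexed by the maps f : 'I_l -> 'I_d, where
   f stands for e_(f 0) (x) ... (x) e_(f (l-1)); the factor B_j of the usual
   1-based numbering is the ordinal j - 1. *)
Local Notation idx := {ffun 'I_l -> 'I_d}.
Local Notation dimB := #|{: idx}|.

Definition ptens (s : 'S_l) (v : 'cV[C]_dimB) : 'cV[C]_dimB :=
  \col_k v (enum_rank [ffun i => (enum_val k : idx) (s i)]) 0.

Definition sym_subspace : set 'cV[C]_dimB :=
  [set v | forall s : 'S_l, ptens s v = v].

Definition ix (a : 'I_d) (f : idx) : 'I_(d * dimB) :=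
  mxtens_index (a, enum_rank f).

Definition ix_fst (k : 'I_(d * dimB)) : 'I_d := (mxtens_unindex k).1.
Definition ix_snd (k : 'I_(d * dimB)) : idx := enum_val (mxtens_unindex k).2.

(* The pairs (f, f') over which the partial trace sums: the B_1-indices are
   the prescribed b, b', and f, f' agree on the traced-out B_2, ..., B_l. *)
Definition agree_after_first (b b' : 'I_d) (f f' : idx) : bool :=
  [forall i : 'I_l,
    if i == 0 :> nat then (f i == b) && (f' i == b') else f i == f' i].

Definition ptrace (X : 'M[C]_(d * dimB)) : 'M[C]_(d * d) :=
  \matrix_(k, k')
    let: (a, b) := mxtens_unindex k in
    let: (a', b') := mxtens_unindex k' in
    \sum_(p : idx * idx | agree_after_first b b' p.1 p.2)
      X (ix a p.1) (ix a' p.2).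

Definition first_of (s : nat) (f f' : idx) : idx :=
  [ffun i : 'I_l => if (i < s)%N then f' i else f i].

(* Partial transpose on B_1, ..., B_s: the row and column indices of these
   factors are exchanged. *)
Definition ptranspose (s : nat) (X : 'M[C]_(d * dimB)) : 'M[C]_(d * dimB) :=
  \matrix_(k, k')
    X (ix (ix_fst k) (first_of s (ix_snd k) (ix_snd k')))
      (ix (ix_fst k') (first_of s (ix_snd k') (ix_snd k))).

End Extensions.

Definition orthoprojector n (V : set 'cV[C]_n) (P : 'M[C]_n) : Prop :=
  [/\ P *m P = P, P^t* = P & forall v, V v <-> P *m v = v].

Lemma orthoprojector_uniq n (V : set 'cV[C]_n) (P Q : 'M[C]_n) :
  orthoprojector V P -> orthoprojector V Q -> P = Q.
Proof.
have half (P' Q' : 'M[C]_n) :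
    orthoprojector V P' -> orthoprojector V Q' -> P' *m Q' = Q'.
  move=> [_ _ VP] [QQ _ VQ]; apply/matrixP => i j.
  have /VP E : V (col j Q') by apply/VQ; rewrite colE mulmxA QQ.
  have /matrixP/(_ i 0) : col j (P' *m Q') = col j Q' by rewrite colE -mulmxA -colE.
  by rewrite [LHS]mxE [RHS]mxE.
move=> hP hQ; have PQ := half _ _ hP hQ; have QP := half _ _ hQ hP.
case: hP hQ => _ PH _ [_ QH _].
have := congr1 (fun A : 'M[C]_n => A^t*) PQ.
by rewrite trmx_mul map_mxM PH QH QP.
Qed.

Section Symmetrizer.
Variables d l : nat.
Local Notation idx := {ffun 'I_l -> 'I_d}.
Local Notation dimB := #|{: idx}|.

Let act (s : 'S_l) (k : 'I_dimB) : 'I_dimB :=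
  enum_rank [ffun i => (enum_val k : idx) (s i)].

Let actM s t k : act t (act s k) = act (t * s)%g k.
Proof. by congr enum_rank; apply/ffunP => i; rewrite !ffunE enum_rankK ffunE permM. Qed.

Let act1 k : act 1%g k = k.
Proof.
rewrite -[RHS]enum_valK; congr enum_rank.
by apply/ffunP => i; rewrite ffunE perm1.
Qed.

Let T (s : 'S_l) : 'M[C]_dimB := \matrix_(k, k') (k' == act s k)%:R.

Let TE s v : T s *m v = ptens s v.
Proof.
apply/matrixP => k j; rewrite !mxE (bigD1 (act s k)) //= mxE eqxx mul1r.
rewrite big1 ?addr0 ?(ord1 j) // => k' /negPf nk.
by rewrite mxE nk mul0r.
Qed.

Let TM s t : T s *m T t = T (t * s)%g.
Proof.
apply/matrixP => k j; rewrite mxE (bigD1 (act s k)) //= !mxE eqxx mul1r.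
rewrite actM big1 ?addr0 // => k' /negPf nk.
by rewrite mxE nk mul0r.
Qed.

Let TH s : (T s)^t* = T s^-1%g.
Proof.
apply/matrixP => k j; rewrite !mxE rmorph_nat; congr (_%:R).
by congr nat_of_bool; apply/eqP/eqP => ->; rewrite actM ?mulVg ?mulgV act1.
Qed.

Lemma sym_orthoprojector_ex :
  exists P, orthoprojector (@sym_subspace d l) P.
Proof.
have n0 : (#|{: 'S_l}|)%:R != 0 :> C.
  by rewrite pnatr_eq0 -lt0n; apply/card_gt0P; exists 1%g.
pose P : 'M[C]_dimB := (#|{: 'S_l}|)%:R^-1 *: \sum_s T s.
have TP s : T s *m P = P.
  rewrite /P -scalemxAr mulmx_sumr; congr (_ *: _).
  rewrite [RHS](reindex_inj (mulIg s)) /=.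
  by apply: eq_bigr => t _; rewrite TM.
have Pfix (m : nat) (A : 'M[C]_(dimB, m)) : (forall s, T s *m A = A) -> P *m A = A.
  move=> hA; rewrite /P -scalemxAl mulmx_suml (eq_bigr (fun=> A)) //.
  by rewrite sumr_const -[A *+ _]scaler_nat scalerA mulVf // scale1r.
exists P; split.
- exact: Pfix.
- rewrite /P linearZ /= map_mxZ fmorphV rmorph_nat; congr (_ *: _).
  rewrite linear_sum /= raddf_sum [RHS](reindex_inj invg_inj) /=.
  by apply: eq_bigr => s _; rewrite TH.
- move=> v; split=> [hv|<- s]; last by rewrite -TE mulmxA TP.
  by apply: Pfix => s; rewrite TE.
Qed.

End Symmetrizer.

(* The projector P below exists and is unique by the two lemmas above. *)
Definition DPS (l d : nat) : set 'M[C]_(d * d) :=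
  [set rho | [/\ psd rho, \tr rho = 1 &
     exists X : 'M[C]_(d * #|{: {ffun 'I_l -> 'I_d}}|),
       [/\ psd X,
           ptrace X = rho,
           exists2 P, orthoprojector (@sym_subspace d l) P
             & (1%:M *t P) *m X *m (1%:M *t P) = X
         & forall s, (1 <= s <= l)%N -> psd (ptranspose s X)]]].

Definition hDPS (l d : nat) (M : 'M[C]_(d * d)) : R := supportfun (@DPS l d) M.

End Operators.

(* Main.v *)
Require Import Defs.
From HB Require Import structures.
From mathcomp Require Import all_boot all_order all_algebra all_fingroup.
From mathcomp Require Import cyclic separable cyclotomic.
From mathcomp Require Import boolp classical_sets reals.
From mathcomp Require Import complex mxtens.
From mathcomp Require Import ring lra zify.

Set Implicit Arguments.
Unset Strict Implicit.
Unset Printing Implicit Defensive.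

Import Order.TTheory GRing.Theory Num.Theory.
Local Open Scope ring_scope.
Local Open Scope sesquilinear_scope.

(** Write [h] for the separable value of [M], so that
    [0 <= <x (x) z | M | x (x) z> <= h |x|^2 |z|^2] for all [x], [z].

    Upper bound.  Let [X] extend a state [rho] of the l-th level, and put
    [N = l / 2].  Every real polynomial [q] of degree at most [N] and every [z]
    give a vector of [(C^d)^{(x) 2N}] that, on [y^{(x) N}] and its conjugate,
    takes the value [Q = sum_k q_k |z|^{2(N-k)} |<z,y>|^{2k} |y|^{2(N-k)}].
    Testing the partial transpose of [X] on the first [N] systems against it
    yields a positive operator [A(z)] on the first factor ([pairing_mx_ge0]):
    it is [X] integrated against the nonnegative kernel [Q^2].  The operator
    [h |z|^2 - M_z], with [M_z] the partial value of [M] at [z], is positive as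
    well, so [Tr A(z) (h |z|^2 - M_z) >= 0] for every [z], and this can be
    averaged over Gaussian [z].  Because [X] is symmetric, Wick contraction
    turns the average of [A(z) (x) |z><z|] into a positive multiple of
    [a rho + b rho_A (x) 1] ([pairing_average]).  The contribution of
    [rho_A (x) 1] to [Tr M] is nonnegative, because [M] is nonnegative on
    product vectors, and it may be dropped; what is left is
    [a Tr (M rho) <= h (a + d b)] ([dps_trace_bound]).

    Here [b = nu (q^2)] and [a + d b = mu (q^2)], where [mu] is the law of
    [|<z,y>|^2] on the sphere and [nu] has density [(1 - t)^{d-1}].  It remains
    to make [d nu (q^2) / mu (q^2)] of order [d^2 / l^2].  The Jacobi
    polynomials [Q_m] of weight [(1 - t)^{d-1}] are orthogonal for [nu], with
    squared norm [1 / (2m + d)], while [mu (Q_j Q_m)] is a quotient of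
    binomials; for [q = sum_{m <= N} m Q_m] both forms have a closed expression
    ([nu_kernel_sqr], [mu_kernel_sqr]) and [nu (q^2) / mu (q^2)] is at
    most [d / (N (N + 1))].

    The Gaussian average is taken over finitely many points: Gauss-Laguerre
    nodes for the squared moduli of the coordinates and roots of unity for
    their phases reproduce all the moments that occur ([gaussian_average]).

    Lower bound.  A product state [|x><x| (x) |y><y|] extends to
    [|x><x| (x) |y><y|^{(x) l}], whose partial transposes replace some of the
    [y] by their conjugates and so stay of rank one; mixtures follow
    ([Sep_sub_DPS]). *)

(** * Finite differences, Jacobi polynomials and the kernel polynomial *)

Section FiniteDifferences.
Variable R : comNzRingType.

Definition fdiff (f : nat -> R) : nat -> R := fun i => f i.+1 - f i.

Lemma eq_iter_fdiff m (f g : nat -> R) : f =1 g -> iter m fdiff f =1 iter m fdiff g.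
Proof. by move=> fg; elim: m => //= m IH i; rewrite /fdiff !IH. Qed.

Lemma iter_fdiffE m f i :
  iter m fdiff f i = \sum_(k < m.+1) (-1) ^+ (m - k) * 'C(m, k)%:R * f (i + k)%N.
Proof.
elim: m i => [|m IH] i /=; first by rewrite big_ord1 /= !mul1r addn0.
rewrite /fdiff !IH [RHS]big_ord_recl /=.
under [in RHS]eq_bigr => k _ do
  rewrite /bump /= add1n subSS binS natrD mulrDr mulrDl addnS.
rewrite big_split /= subn0 bin0 mulr1 addn0.
rewrite [X in _ = _ + (X + _)]big_ord_recr /= bin_small // mulr0 mul0r addr0.
under eq_bigr => k _ do rewrite addSn.
rewrite [X in _ = _ + X]addrC addrCA; congr (_ + _).
rewrite big_ord_recl /= subn0 addn0 bin0 mulr1 exprS mulN1r mulNr opprD; congr (_ + _).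
rewrite -sumrN; apply: eq_bigr => k _; rewrite /bump /= add1n addnS.
by rewrite -[in RHS](@prednK (m - k)) ?subn_gt0 // subnS exprS !mulN1r !mulNr.
Qed.

(** The m-th difference keeps only the coefficient of degree [m].  The
    alternating binomial sums below that express orthogonality and
    normalisation are of this kind. *)
Lemma iter_fdiff_horner (p : {poly R}) m i : (size p <= m.+1)%N ->
  iter m fdiff (fun j => p.[j%:R]) i = p`_m * m`!%:R.
Proof.
elim: m p => [|m IH] p sp.
  by rewrite /= [p]size1_polyC // hornerC coefC mulr1.
(* The difference of [p] is the polynomial [p(X + 1) - p(X)], of smaller degree. *)
pose dp := p \Po ('X + 1%:P) - p.
have E k : dp`_k = \sum_(j < m.+2) p`_j * (('C(j, k))%:R - (k == j)%:R).
  rewrite coefB coef_comp_poly -[X in _ - X](coef_Poly p k) polyseqK.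
  have -> : p`_k = \sum_(j < m.+2) p`_j * (k == j)%:R.
    have [km|mk] := ltnP k m.+2.
      rewrite (bigD1 (Ordinal km)) //= eqxx mulr1 big1 ?addr0 // => j /eqP jk.
      case: eqP => [kj|]; last by rewrite mulr0.
      by case: jk; apply: val_inj.
    rewrite big1 => [|j _]; first by rewrite nth_default // (leq_trans sp).
    by rewrite gtn_eqF ?mulr0 // (leq_trans _ mk).
  transitivity (\sum_(j < m.+2) p`_j * ('C(j, k))%:R - \sum_(j < m.+2) p`_j * (k == j)%:R);
    last by rewrite -sumrB; apply: eq_bigr => j _; rewrite mulrBr.
  congr (_ - _); rewrite (big_ord_widen_cond m.+2 predT (fun j => p`_j * (('X + 1%:P) ^+ j)`_k)) //=.
  rewrite big_mkcond; apply: eq_bigr => j _; case: ifP => [_|/negbT]; last first.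
    by rewrite -leqNgt => /(nth_default 0) ->; rewrite mul0r.
  congr (_ * _); rewrite addrC exprDn coef_sum.
  under eq_bigr => t _ do rewrite coefMn -polyC_exp expr1n mul1r coefXn.
  have [kj|jk] := ltnP k j.+1.
    rewrite (bigD1 (Ordinal kj)) //= eqxx big1 ?addr0 // => t /eqP tk.
    case: eqP => [kt|]; last by rewrite mul0rn.
    by case: tk; apply: val_inj.
  rewrite bin_small // big1 // => t _; rewrite gtn_eqF ?mul0rn //.
  exact: leq_trans (ltn_ord t) jk.
have sdp : (size dp <= m.+1)%N.
  apply/leq_sizeP => k mk; rewrite E big1 // => j _.
  have [kj|jk|kj] := ltngtP k j.
  - by have := leq_ltn_trans mk (leq_trans kj (ltn_ord j : (j <= m.+1)%N)); rewrite ltnn.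
  - by rewrite bin_small // subr0 mulr0.
  - by rewrite kj binn subrr mulr0.
rewrite iterSr (@eq_iter_fdiff m _ (fun j => dp.[j%:R])) => [|j]; last first.
  by rewrite /fdiff /dp hornerD hornerN horner_comp hornerD hornerX hornerC -natr1.
rewrite IH // E !big_ord_recr /= big1 => [|j _]; last first.
  by rewrite bin_small ?(gtn_eqF (ltn_ord j)) ?subrr ?mulr0.
by rewrite binn eqxx subrr mulr0 !add0r binSn ltn_eqF // subr0 factS natrM mulrA.
Qed.

(** Pascal's rule: each difference lowers the lower index by one.  Here the
    degree exceeds the number of differences, so that [iter_fdiff_horner] says
    nothing. *)
Lemma iter_fdiff_bin a n i : (a <= n)%N ->
  iter a fdiff (fun j => 'C(n + j, n)%:R) i = 'C(n + i, n - a)%:R.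
Proof.
elim: a i => [|a IH] i an /=; first by rewrite subn0.
rewrite /fdiff !IH ?(ltnW an) // addnS.
by rewrite -(@prednK (n - a)) ?subn_gt0 // binS natrD -subnS addrC addKr.
Qed.

End FiniteDifferences.

Section Moments.
Variables (R : realFieldType) (c : nat -> R).

(** Measures on the unit interval enter only through their moments. *)
Definition mom (p : {poly R}) : R := \sum_(i < size p) p`_i * c i.

Lemma mom_widen N (p : {poly R}) : (size p <= N)%N -> mom p = \sum_(i < N) p`_i * c i.
Proof.
move=> sp; rewrite /mom (big_ord_widen_cond N predT (fun i => p`_i * c i)) //=.
rewrite big_mkcond; apply: eq_bigr => j _; case: ifP => // /negbT.
by rewrite -leqNgt => /(nth_default 0) ->; rewrite mul0r.
Qed.

Fact mom_is_linear : linear_for *%R mom.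
Proof.
move=> a p q; pose N := maxn (size p) (size q).
have sN : (size (a *: p + q)%R <= N)%N.
  rewrite (leq_trans (size_polyD _ _)) // geq_max leq_maxr andbT.
  by rewrite (leq_trans (size_scale_leq _ _)) // leq_maxl.
rewrite (mom_widen sN) (@mom_widen N p (leq_maxl _ _)) (@mom_widen N q (leq_maxr _ _)).
rewrite mulr_sumr -big_split; apply: eq_bigr => i _.
by rewrite coefD coefZ mulrDl mulrA.
Qed.

HB.instance Definition _ := GRing.isLinear.Build R {poly R} R *%R mom mom_is_linear.

Lemma momXn k : mom 'X^k = c k.
Proof.
rewrite /mom size_polyXn (bigD1 ord_max) //= coefXn eqxx mul1r big1 ?addr0 //.
move=> i /eqP ik; rewrite coefXn; case: eqP => [e|]; last by rewrite mul0r.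
by case: ik; apply: val_inj.
Qed.

Lemma mom_sqr n (q : {poly R}) : (size q <= n)%N ->
  mom (q ^+ 2) = \sum_(k < n) \sum_(k' < n) q`_k * q`_k' * c (k' + k)%N.
Proof.
move=> sq; have qE : q = \sum_(k < n) q`_k *: 'X^k.
  rewrite -poly_def; apply/polyP => i; rewrite coef_poly; case: ltnP => // ni.
  by rewrite nth_default // (leq_trans sq).
have E k : mom ('X^k * q) = \sum_(k' < n) q`_k' * c (k' + k)%N.
  rewrite [X in 'X^k * X]qE ['X^k * _]mulr_sumr linear_sum; apply: eq_bigr => k' _ /=.
  by rewrite -scalerAr linearZ /= -exprD momXn addnC.
rewrite expr2 [X in X * q]qE mulr_suml linear_sum; apply: eq_bigr => k _ /=.
by rewrite -scalerAl linearZ /= E mulr_sumr; apply: eq_bigr => k' _; rewrite mulrA.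
Qed.

End Moments.

Section Jacobi.
Variables (R : realFieldType) (g : nat).

(** The moments of the density [(1 - t)^g] on the unit interval. *)
Definition nu_moment k : R := k`!%:R * g`!%:R / (k + g).+1`!%:R.
(** The moments of the density [g (1 - t)^{g-1}], which is the law of
    [|<z,y>|^2] for unit vectors [y] fixed and [z] uniform in dimension [g + 1];
    for [g = 0] they are those of the point mass at 1. *)
Definition mu_moment k : R := k`!%:R * g`!%:R / (k + g)`!%:R.

Notation nu := (mom nu_moment).
Notation mu := (mom mu_moment).

(** The Jacobi polynomial [P_m^{(g,0)}] on the unit interval, scaled to have
    constant term [(-1)^m]. *)
Definition jacobi m : {poly R} :=
  \poly_(i < m.+1) ((-1) ^+ (m - i) * 'C(m, i)%:R * 'C(m + g + i, i)%:R).

Lemma fact_neq0 k : k`!%:R != 0 :> R.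
Proof. by rewrite pnatr_eq0 -lt0n fact_gt0. Qed.

Lemma size_jacobi m : (size (jacobi m) <= m.+1)%N.
Proof. exact: size_poly. Qed.

Lemma bin_factR n m : (m <= n)%N ->
  'C(n, m)%:R * (m`!%:R * (n - m)`!%:R) = n`!%:R :> R.
Proof. by move=> mn; rewrite -!natrM bin_fact. Qed.

(** As measures, [(1 - t) mu = g nu]. *)
Lemma mu_sub_mu k : mu_moment k - mu_moment k.+1 = g%:R * nu_moment k.
Proof.
rewrite /mu_moment /nu_moment addSn !factS !natrM.
rewrite -!natr1 natrD; field; rewrite !fact_neq0 /=. by rewrite -natrD natr1 pnatr_eq0.
Qed.

Lemma mu_nu k : mu_moment k = (k + g.+1)%:R * nu_moment k.
Proof.
rewrite /mu_moment /nu_moment factS !natrM addnS.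
by field; rewrite fact_neq0 /=; rewrite -?natrD ?natr1 ?nat1r pnatr_eq0.
Qed.

Lemma mom_mulXn_jacobi (c : nat -> R) k m :
  mom c ('X^k * jacobi m) =
  \sum_(i < m.+1) (-1) ^+ (m - i) * 'C(m, i)%:R * ('C(m + g + i, i)%:R * c (i + k)%N).
Proof.
rewrite /jacobi poly_def mulr_sumr linear_sum /=; apply: eq_bigr => i _.
rewrite -scalerAr -exprD linearZ /= momXn [(k + i)%N]addnC !mulrA //.
Qed.

Definition rising c a : {poly R} := \prod_(j < a) ('X - (- (c + j).+1%:R)%:P).

Lemma size_rising c a : size (rising c a) = a.+1.
Proof. by rewrite size_prod_XsubC -sum1_size big_const_ord iter_addn_0 mul1n. Qed.

Lemma rising_monic c a : rising c a \is monic.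
Proof. exact: monic_prod_XsubC. Qed.

Lemma horner_rising c a i : (rising c a).[i%:R] = (c + a + i)`!%:R / (c + i)`!%:R.
Proof.
elim: a => [|a IH]; first by rewrite /rising big_ord0 hornerC addn0 divff ?fact_neq0.
rewrite /rising big_ord_recr hornerM IH !hornerE addnS addSn factS natrM -!natr1 !natrD.
by field; rewrite fact_neq0.
Qed.

(** Up to a constant factor this sum is the m-th difference of
    [i |-> (m+g+i)! (i+k)! / ((i+k+g+1)! i!)], which for [k < m] is a product
    of [m - 1] linear factors. *)
Lemma nu_mulXn_jacobi k m : (k < m)%N -> nu ('X^k * jacobi m) = 0.
Proof.
move=> km; rewrite mom_mulXn_jacobi.
(* [(m+g+i)! / (k+g+1+i)!] times [(i+k)! / i!]. *)
pose p := rising (k + g).+1 (m - k.+1) * rising 0 k.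
have sp : (size p <= m)%N.
  rewrite (leq_trans (size_polyMleq _ _)) // !size_rising addnS /= addSn.
  by rewrite -addnS subnK.
have := @iter_fdiff_horner R p m 0 (leqW sp).
rewrite nth_default // mul0r iter_fdiffE => h.
apply: (mulfI (fact_neq0 (m + g))); rewrite mulr0.
transitivity (g`!%:R * 0 : R); last exact: mulr0.
rewrite -[X in _ = _ * X]h !mulr_sumr; apply: eq_bigr => i _.
rewrite [RHS]mulrCA [LHS]mulrCA; congr (_ * _).
rewrite hornerM !horner_rising !add0n /nu_moment.
have -> : ((k + g).+1 + (m - k.+1) + i = m + g + i)%N by lia.
have -> : (i + k + g = k + g + i)%N by lia.
rewrite addSn [(i + k)%N]addnC -(bin_factR (leq_addl (m + g) i)) addnK.
by field; rewrite !fact_neq0.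
Qed.

(** The same as for [nu_mulXn_jacobi], with [m] linear factors: the difference
    is now [m!]. *)
Lemma mu_jacobi m : mu (jacobi m) = 'C(m + g, m)%:R^-1.
Proof.
rewrite -[jacobi m]mul1r -(expr0 'X) mom_mulXn_jacobi.
have := @iter_fdiff_horner R (rising g m) m 0.
rewrite size_rising => /(_ (leqnn _)); have /eqP := rising_monic g m.
rewrite lead_coefE size_rising /= => -> ; rewrite mul1r iter_fdiffE => h.
apply: (mulfI (fact_neq0 (m + g))).
rewrite -[in RHS](bin_factR (leq_addr g m)) addKn [RHS]mulrAC divff; last first.
  by rewrite pnatr_eq0 -lt0n bin_gt0 leq_addr.
rewrite mul1r -h mulr_suml mulr_sumr; apply: eq_bigr => i _.
rewrite horner_rising add0n [(g + m)%N]addnC /mu_moment addn0 [(i + g)%N]addnC.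
rewrite -(bin_factR (leq_addl (m + g) i)) addnK.
by field; rewrite !fact_neq0.
Qed.

Lemma jacobi_horner1 m : (jacobi m).[1] = 'C(m + g, m)%:R.
Proof.
have := @iter_fdiff_bin R m (m + g) 0 (leq_addr _ _).
rewrite iter_fdiffE addn0 addKn -(bin_sub (leq_addr g m)) addKn => <-.
rewrite horner_poly; apply: eq_bigr => i _.
by rewrite expr1n mulr1 add0n -(bin_sub (leq_addl _ _)) addnK.
Qed.

(** [(1 - t) mu = g nu], and [nu] kills [t^k Q_m] for [k < m]: the moment does
    not change from [k] to [k + 1]. *)
Lemma mu_mulXn_jacobi k m : (k <= m)%N -> mu ('X^k * jacobi m) = 'C(m + g, m)%:R^-1.
Proof.
elim: k => [|k IH] km; first by rewrite mul1r mu_jacobi.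
rewrite -IH ?(ltnW km) //; apply/eqP; rewrite eq_sym -subr_eq0; apply/eqP.
transitivity (g%:R * nu ('X^k * jacobi m)); last by rewrite nu_mulXn_jacobi ?mulr0.
rewrite !mom_mulXn_jacobi -sumrB mulr_sumr; apply: eq_bigr => i _.
rewrite addnS -!mulrBr mu_sub_mu.
by rewrite [in RHS]mulrCA; congr (_ * _); rewrite mulrCA.
Qed.

Lemma nu_mul_jacobi (p : {poly R}) m : (size p <= m)%N -> nu (p * jacobi m) = 0.
Proof.
move=> sp; rewrite -[p]coefK poly_def mulr_suml linear_sum big1 // => i _.
by rewrite -scalerAl linearZ /= nu_mulXn_jacobi ?mulr0 // (leq_trans _ sp).
Qed.

(** Against polynomials of degree at most [m], [Q_m mu] acts as a multiple of
    the point mass at 1; this is what makes all products of two Jacobi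
    polynomials explicit. *)
Lemma mu_mul_jacobi (p : {poly R}) m : (size p <= m.+1)%N ->
  mu (p * jacobi m) = p.[1] / 'C(m + g, m)%:R.
Proof.
move=> sp; rewrite horner_coef -{1}[p]coefK poly_def !mulr_suml linear_sum.
apply: eq_bigr => i _; rewrite -scalerAl linearZ /= mu_mulXn_jacobi ?expr1n ?mulr1 //.
by rewrite -ltnS (leq_trans _ sp).
Qed.

Lemma mu_jacobi2 j m : (j <= m)%N ->
  mu (jacobi j * jacobi m) = 'C(j + g, j)%:R / 'C(m + g, m)%:R.
Proof.
by move=> jm; rewrite mu_mul_jacobi ?jacobi_horner1 // (leq_trans (size_jacobi _)).
Qed.

(** Integration by parts, read on monomials. *)
Lemma mu_nu_deriv p : mu p = g.+1%:R * nu p + nu ('X * p^`()).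
Proof.
have E i : ('X * p^`())`_i = i%:R * p`_i.
  rewrite coefXM coef_deriv; case: i => [|i] /=; first by rewrite mul0r.
  by rewrite mulr_natl.
have sp : (size ('X * p^`())%R <= size p)%N.
  by apply/leq_sizeP => j pj; rewrite E nth_default ?mulr0.
rewrite (mom_widen _ sp) /mom mulr_sumr -big_split /=; apply: eq_bigr => i _.
by rewrite E mu_nu natrD; ring.
Qed.

(** The operator [t d/dt] multiplies [Q_m] by [m] up to terms of smaller degree,
    which [nu] does not see; hence [mu (Q_m^2) = (g + 1 + 2 m) nu (Q_m^2)]. *)
Lemma nu_jacobi_sqr m : nu (jacobi m ^+ 2) = (m.*2 + g.+1)%:R^-1.
Proof.
have h : mu (jacobi m ^+ 2) = 1.
  by rewrite expr2 mu_jacobi2 // divff // pnatr_eq0 -lt0n bin_gt0 leq_addr.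
(* The leading coefficients cancel, so that [p] is orthogonal to [Q_m]. *)
pose p := 'X * (jacobi m)^`() - m%:R *: jacobi m.
have sp : (size p <= m)%N.
  apply/leq_sizeP => j mj; rewrite coefB coefZ coefXM coef_deriv !coef_poly.
  case: j mj => [|j] mj /=; first by move: mj; rewrite leqn0 => /eqP ->; rewrite mul0r subr0.
  rewrite ltnS; case: (ltngtP j.+1 m) mj => // [_|<-] _.
    by rewrite mul0rn mulr0 subr0.
  by rewrite -[X in X - _]mulr_natl subrr.
have := nu_mul_jacobi sp; rewrite mulrBl linearB /= -scalerAl linearZ /= => /subr0_eq e.
move: h; rewrite mu_nu_deriv expr2 derivM.
rewrite [jacobi m * _^`()]mulrC -mulr2n mulrnAr linearMn /= mulrA e.
rewrite -mulrnAl -expr2 -mulrDl -mulrnA muln2 -natrD addnC => h.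
by apply: (mulfI (_ : _ != 0)) (etrans h (esym (divff _))); rewrite pnatr_eq0 addnS.
Qed.

Definition triangle n : nat := \sum_(m < n) m.

(** A hockey-stick identity. *)
Lemma sum_mul_bin m :
  (\sum_(j < m.+1) j * 'C(j + g, j) * g.+2 = m * (m + g.+1) * 'C(m + g, m))%N.
Proof.
elim: m => [|m IH]; first by rewrite big_ord1 !mul0n.
rewrite big_ord_recr /= IH.
have h : (m.+1 * 'C(m.+1 + g, m.+1) = (m + g).+1 * 'C(m + g, m))%N.
  by rewrite addSn -mul_bin_diag.
have -> : (m * (m + g.+1) * 'C(m + g, m) = m * (m.+1 * 'C(m.+1 + g, m.+1)))%N.
  by rewrite h addnS mulnA.
by ring.
Qed.

(** The weights [m] concentrate [q^2] near 1 at scale [((g + 1) / n)^2], as the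
    extremal polynomial would, and keep both quadratic forms summable. *)
Definition kernel_poly n : {poly R} := \sum_(m < n) m%:R *: jacobi m.

Lemma size_kernel_poly n : (size (kernel_poly n) <= n)%N.
Proof.
rewrite (leq_trans (size_sum _ _ _)) //; apply/bigmax_leqP => m _.
rewrite (leq_trans (size_scale_leq _ _)) // (leq_trans (size_jacobi _)) //.
Qed.

Lemma kernel_polyS n : kernel_poly n.+1 = kernel_poly n + n%:R *: jacobi n.
Proof. by rewrite /kernel_poly big_ord_recr. Qed.

Lemma nu_kernel_sqr n :
  nu (kernel_poly n ^+ 2) = \sum_(m < n) m%:R ^+ 2 / (m.*2 + g.+1)%:R.
Proof.
elim: n => [|n IH]; first by rewrite /kernel_poly !big_ord0 expr0n linear0.
rewrite kernel_polyS sqrrD big_ord_recr /= [LHS]linearD /= [X in X + _]linearD /= IH.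
rewrite linearMn /= -scalerAr linearZ /= nu_mul_jacobi ?size_kernel_poly // mulr0 mul0rn addr0.
by rewrite exprZn linearZ /= nu_jacobi_sqr.
Qed.

Lemma mu_kernel_sqr n :
  mu (kernel_poly n ^+ 2) = \sum_(m < n) m%:R ^+ 2 * (m.*2 + g)%:R / g.+2%:R.
Proof.
elim: n => [|n IH]; first by rewrite /kernel_poly !big_ord0 expr0n linear0.
rewrite kernel_polyS sqrrD big_ord_recr /= [LHS]linearD /= [X in X + _]linearD /= IH.
rewrite linearMn /= -addrA; congr (_ + _).
rewrite -scalerAr exprZn !linearZ /= expr2 mu_jacobi2 //.
have b0 : 'C(n + g, n)%:R != 0 :> R by rewrite pnatr_eq0 -lt0n bin_gt0 leq_addr.
rewrite mu_mul_jacobi ?(leq_trans (size_kernel_poly _)) //.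
have -> : (kernel_poly n).[1] = n%:R * (n%:R - 1) / g.+2%:R * 'C(n + g, n)%:R.
  rewrite /kernel_poly horner_sum.
  under eq_bigr => j _ do rewrite hornerZ jacobi_horner1.
  have /(congr1 (fun x => x%:R : R)) := sum_mul_bin n.
  rewrite big_ord_recr /= !natrD !natrM natr_sum.
  under eq_bigr => j _ do rewrite !natrM.
  rewrite -mulr_suml => e.
  apply: (mulIf (_ : g.+2%:R != 0 :> R)); first by rewrite pnatr_eq0.
  rewrite -[X in X = _](addrK (n%:R * 'C(n + g, n)%:R * g.+2%:R)) e.
  rewrite -!natr1 natrD; field.
  by apply: lt0r_neq0; have := ler0n R g; lra.
rewrite -mul2n natrD natrM -!natr1; field.
rewrite b0 ?andbT /=.
by apply: lt0r_neq0; have := ler0n R g; lra.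
Qed.

Lemma nu_kernel_sqr_ge0 n : 0 <= nu (kernel_poly n ^+ 2).
Proof. by rewrite nu_kernel_sqr sumr_ge0 // => m _; rewrite divr_ge0 ?exprn_ge0 ?ler0n. Qed.

Lemma nu_kernel_le n : nu (kernel_poly n ^+ 2) <= (triangle n)%:R / 2.
Proof.
rewrite nu_kernel_sqr natr_sum mulr_suml; apply: ler_sum => m _.
have e : (m.*2 + g.+1)%:R = 2 * m%:R + g%:R + 1 :> R.
  by rewrite -mul2n addnS -natr1 natrD natrM.
rewrite ler_pdivrMr ?ltr0n ?addnS // -addnS e.
have := ler0n R m; have := ler0n R g; nra.
Qed.

Lemma triangleE n : (2 * triangle n.+1 = n * n.+1)%N.
Proof.
elim: n => [|n IH]; first by rewrite /triangle big_ord1.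
by rewrite /triangle big_ord_recr /= mulnDr IH; ring.
Qed.

(** The sum of cubes; it makes the lower bound on [mu (q^2)] and the upper bound
    on [nu (q^2)] functions of the same number. *)
Lemma triangle_sqr n : (triangle n ^ 2 = \sum_(m < n) m ^ 3)%N.
Proof.
elim: n => [|n IH]; first by rewrite /triangle !big_ord0.
rewrite big_ord_recr /= -IH.
have := triangleE n; rewrite /triangle !big_ord_recr /=; nia.
Qed.

Lemma mu_kernel_ge n : (triangle n)%:R ^+ 2 / g.+1%:R <= mu (kernel_poly n ^+ 2).
Proof.
rewrite mu_kernel_sqr -natrX triangle_sqr natr_sum mulr_suml; apply: ler_sum => m _.
rewrite ler_pdivrMr ?ltr0n // mulrAC ler_pdivlMr ?ltr0n //.
rewrite -!natrX -!natrM ler_nat -mul2n; nia.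
Qed.

End Jacobi.

(** * A finite quadrature for the complex Gaussian *)

Section Quadrature.
Variable C : numClosedFieldType.

Lemma sum_ord_delta m l (u : nat -> C) :
  \sum_(j < m) (j == l :> nat)%:R * u j = if (l < m)%N then u l else 0.
Proof.
case: ifP => [lm|/negbT lm].
  rewrite (bigD1 (Ordinal lm)) //= eqxx mul1r big1 ?addr0 // => j /eqP jl.
  case: eqP => [e|_]; last by rewrite mul0r.
  by case: jl; apply: val_inj.
rewrite big1 // => j _; case: eqP => [e|_]; last by rewrite mul0r.
by move: lm; rewrite -e ltn_ord.
Qed.

Section Laguerre.
Variable n : nat.

(** A bidiagonal factor of the Jacobi matrix of the Laguerre polynomials, the
    tridiagonal matrix with diagonal [2 i + 1] and off-diagonal entries [i + 1]
    (signs of the odd polynomials changed).  The factorisation shows that the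
    nodes are nonnegative. *)
Definition laguerre_root : 'M[C]_n.+1 :=
  \matrix_(i, j) (sqrtC i.+1%:R * ((j == i :> nat)%:R + (j == i.+1 :> nat)%:R)).

Definition laguerre_mx : 'M[C]_n.+1 := laguerre_root^t* *m laguerre_root.

Lemma conj_sqrt_nat k : (sqrtC k%:R : C)^* = sqrtC k%:R.
Proof. by rewrite conj_Creal // ger0_real // sqrtC_ge0 ler0n. Qed.

Lemma laguerre_mx_mul (u : nat -> C) : u n.+1 = 0 ->
  forall i : 'I_n.+1,
  (laguerre_mx *m (\col_(j < n.+1) u j)) i 0 =
    i.+1%:R * (u i + u i.+1) + i%:R * (u i.-1 + u i).
Proof.
move=> u0 i; rewrite /laguerre_mx -mulmxA mxE.
pose v l := l.+1%:R * (u l + u l.+1) : C.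
transitivity (\sum_(l < n.+1) ((l == i :> nat)%:R * v l + (l.+1 == i :> nat)%:R * v l)).
  apply: eq_bigr => l _; rewrite !mxE rmorphM rmorphD !rmorph_nat /= conj_sqrt_nat.
  under eq_bigr => j _ do rewrite !mxE -mulrA mulrDl.
  rewrite -mulr_sumr big_split /= !sum_ord_delta ltn_ord.
  have -> : (if (l.+1 < n.+1)%N then u l.+1 else 0) = u l.+1.
    case: ltnP => // h; suff -> : l = n :> nat by rewrite u0.
    by apply/eqP; rewrite eqn_leq -ltnS ltn_ord.
  rewrite mulrACA -expr2 sqrtCK /v mulrCA mulrDl.
  by congr (_%:R * _ + _%:R * _); rewrite eq_sym.
rewrite big_split /= sum_ord_delta ltn_ord; congr (_ + _).
case: (i : nat) (ltn_ord i) => [|k] kn; first by rewrite big1 ?mul0r // => l _; rewrite mul0r.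
under eq_bigr => l _ do rewrite eqSS.
by rewrite sum_ord_delta ltnW.
Qed.

(** The first column of the k-th power holds the coordinates of [r^k] in the
    Laguerre basis.  Truncating the matrix at order [n] only matters from
    the power [n + 1] on. *)
Lemma laguerre_mx_exp k : (k <= n)%N ->
  forall i, (laguerre_mx ^+ k) i 0 = (k`! * 'C(k, i))%:R.
Proof.
elim: k => [|k IH] kn i.
  by rewrite expr0 mxE mul1n bin0n -val_eqE.
have e : col 0 (laguerre_mx ^+ k) = \col_(j < n.+1) (k`! * 'C(k, j))%:R.
  by apply/matrixP => j t; rewrite !mxE IH // ltnW.
have -> : (laguerre_mx ^+ k.+1) i 0 = (laguerre_mx *m col 0 (laguerre_mx ^+ k)) i 0.
  rewrite exprS -mulmxE [LHS]mxE [RHS]mxE; apply: eq_bigr => j _.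
  by congr (_ * _); rewrite [RHS]mxE.
rewrite e (@laguerre_mx_mul (fun j => (k`! * 'C(k, j))%:R)); last first.
  by rewrite bin_small ?muln0 // leqW.
rewrite -!natrD -!natrM -natrD factS; congr (_%:R).
rewrite -!mulnDr.
case: (i : nat) => [|j]; first by rewrite !bin0 bin1; ring.
rewrite /=.
have h1 : ('C(k, j) + 'C(k, j.+1) = 'C(k.+1, j.+1))%N by rewrite binS addnC.
have h2 : ('C(k, j.+1) + 'C(k, j.+2) = 'C(k.+1, j.+2))%N by rewrite binS addnC.
rewrite h1 h2.
(* Absorption, for the recurrence satisfied by [k! C(k, j)]. *)
have h3 : (k.+1 * 'C(k, j.+1) = j.+2 * 'C(k.+1, j.+2))%N by rewrite mul_bin_diag.
have h4 : (k.+1 * 'C(k, j) = j.+1 * 'C(k.+1, j.+1))%N by rewrite mul_bin_diag.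
have -> : (j.+2 * (k`! * 'C(k.+1, j.+2)) + j.+1 * (k`! * 'C(k.+1, j.+1)) =
  k`! * (j.+2 * 'C(k.+1, j.+2) + j.+1 * 'C(k.+1, j.+1)))%N by ring.
by rewrite -h3 -h4 -h1; ring.
Qed.

(** The spectral measure of the first basis vector: eigenvalues as nodes,
    squared first coordinates of the eigenvectors as weights. *)
Lemma laguerre_quadrature : exists w x : 'I_n.+1 -> C,
  [/\ forall j, 0 <= w j, forall j, 0 <= x j
    & forall k, (k <= n)%N -> \sum_j w j * x j ^+ k = k`!%:R].
Proof.
have herm : laguerre_mx^t* = laguerre_mx.
  by rewrite /laguerre_mx trmx_mul map_mxM trmxCK.
have /orthomx_spectralP : laguerre_mx \is normalmx by apply/normalmxP; rewrite herm.
set P := spectralmx _; set D := spectral_diag _ => eJ.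
have PU : P \is unitarymx by apply: spectral_unitarymx.
have invP := invmx_unitary PU.
have /unitarymxP PP := PU.
have eJk k : laguerre_mx ^+ k = P^t* *m diag_mx (\row_j D 0 j ^+ k) *m P.
  elim: k => [|k IH].
    rewrite expr0 (_ : diag_mx _ = 1%:M) ?mulmx1 -?invP ?mulVmx ?unitarymx_unit //.
    by apply/matrixP => i j; rewrite !mxE expr0.
  rewrite exprSr IH eJ invP -!mulmxE !mulmxA mulmxtVK //.
  rewrite -[_ *m diag_mx _ *m diag_mx _]mulmxA; congr (_ *m _ *m _).
  by apply/matrixP => i j; rewrite mul_diag_mx !mxE exprSr mulrnAr.
exists (fun j => `|P j 0| ^+ 2), (fun j => D 0 j); split.
- by move=> j; rewrite exprn_ge0.
- move=> j.
  have -> : D 0 j = (P *m laguerre_mx *m P^t*) j j.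
    rewrite eJ invP !mulmxA PP mul1mx -mulmxA PP mulmx1.
    by rewrite mxE eqxx.
  rewrite /laguerre_mx.
  have -> : P *m (laguerre_root^t* *m laguerre_root) *m P^t* =
    (laguerre_root *m P^t*)^t* *m (laguerre_root *m P^t*).
    by rewrite trmx_mul map_mxM trmxCK !mulmxA.
  rewrite mxE sumr_ge0 // => i _.
  set A := laguerre_root *m P^t*.
  have -> : A^t* j i = (A i j)^* by rewrite !mxE.
  by rewrite mulrC mul_conjC_ge0.
- move=> k kn.
  have := laguerre_mx_exp kn 0; rewrite bin0 muln1 => <-.
  rewrite eJk -mulmxA mxE; apply: eq_bigr => j _.
  rewrite mul_diag_mx !mxE normCK; ring.
Qed.

End Laguerre.

(** [X^(n+1) - 1] splits with distinct roots, and the finite group that they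
    form is cyclic. *)
Lemma prim_root_exists n : exists z : C, n.+1.-primitive_root z.
Proof.
pose p : {poly C} := 'X^(n.+1) - 1.
have [r Dp] := closed_field_poly_normal p.
move: Dp; rewrite (monicP _) ?monicXnsubC // scale1r => Dp.
have rn1 : all n.+1.-unity_root r.
  by apply/allP => z; rewrite -root_prod_XsubC -Dp.
have sz_r : (n.+1 < (size r).+1)%N.
  by rewrite -(size_prod_XsubC r id) -Dp size_XnsubC.
have [|z] := hasP (has_prim_root (ltn0Sn n) rn1 _ sz_r); last by exists z.
by rewrite -separable_prod_XsubC -Dp separable_Xn_sub_1 // pnatr_eq0.
Qed.

Lemma circle_quadrature n : exists z : 'I_n.+1 -> C,
  (forall j, `|z j| = 1) /\
  forall a b, (a <= n)%N -> (b <= n)%N ->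
    n.+1%:R^-1 * \sum_j z j ^+ a * (z j)^* ^+ b = (a == b)%:R.
Proof.
have [w wP] := prim_root_exists n.
have w1 : `|w| = 1.
  apply/eqP; rewrite -(@pexpr_eq1 _ _ n.+1) ?normr_ge0 //.
  by rewrite -normrX (prim_expr_order wP) normr1.
exists (fun j => w ^+ j); split=> [j|a b an bn]; first by rewrite normrX w1 expr1n.
have ww : w * w^* = 1 by rewrite -normCK w1 expr1n.
(* A geometric sum of ratio [w^(a-b)], a root of unity different from 1 unless [a = b]. *)
pose x := w ^+ a * w^* ^+ b.
have -> : \sum_(j < n.+1) (w ^+ j) ^+ a * (w ^+ j)^* ^+ b = \sum_(j < n.+1) x ^+ j.
  apply: eq_bigr => j _; rewrite rmorphXn /= /x exprMn -!exprM.
  by rewrite ![(j * _)%N]mulnC.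
have xw : x * w ^+ b = w ^+ a by rewrite /x -mulrA -exprMn [w^* * _]mulrC ww expr1n mulr1.
case: eqP => [ab|/eqP ab].
  have -> : x = 1 by rewrite /x ab -exprMn ww expr1n.
  under eq_bigr do rewrite expr1n.
  by rewrite sumr_const card_ord mulVf // pnatr_eq0.
have x1 : x != 1.
  apply: contra ab => /eqP e; have := eq_prim_root_expr wP a b.
  by rewrite -xw e mul1r eqxx !modn_small.
have xn : x ^+ n.+1 = 1.
  rewrite /x exprMn -!exprM ![(_ * n.+1)%N]mulnC !exprM (prim_expr_order wP).
  by rewrite -rmorphXn (prim_expr_order wP) rmorph1 !expr1n mulr1.
have := subrX1 x n.+1; rewrite xn subrr => /esym/eqP.
rewrite mulf_eq0 subr_eq0 (negPf x1) /= => /eqP.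
by move=> ->; rewrite mulr0.
Qed.

(** A standard complex Gaussian has an exponential squared modulus and an
    independent uniform phase. *)
Lemma gaussian_quadrature n : exists (K : finType) (w z : K -> C),
  (forall j, 0 <= w j) /\
  forall a b, (a <= n)%N -> (b <= n)%N ->
    \sum_j w j * ((z j)^* ^+ a * z j ^+ b) = (a == b)%:R * a`!%:R.
Proof.
have [w [x [w0 x0 wx]]] := laguerre_quadrature n.
have [y [_ yP]] := circle_quadrature n.
exists ('I_n.+1 * 'I_n.+1)%type.
exists (fun p => w p.1 * n.+1%:R^-1), (fun p => sqrtC (x p.1) * y p.2); split.
  by move=> j; rewrite mulr_ge0 // invr_ge0 ler0n.
move=> a b an bn; rewrite eq_sym.
(* Radius [sqrt r_i] and phase [y_j]; the exponent [a + b] of the radius is [2 a] on the diagonal. *)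
pose r j := sqrtC (x j).
transitivity (\sum_i \sum_j (w i * r i ^+ (a + b)) * (n.+1%:R^-1 * (y j ^+ b * (y j)^* ^+ a))).
  rewrite pair_bigA; apply: eq_bigr => -[i j] _ /=.
  have -> : (r i * y j)^* = r i * (y j)^*.
    by rewrite rmorphM /= [X in X * _]conj_Creal // ger0_real // sqrtC_ge0.
  rewrite !exprMn exprD; ring.
under eq_bigr => i _ do rewrite -mulr_sumr -mulr_sumr yP //.
rewrite -mulr_suml; case: eqP => [->|_]; last by rewrite mulr0 mul0r.
rewrite mul1r mulr1 -(wx a an); apply: eq_bigr => j _.
by rewrite addnn -mul2n exprM sqrtCK.
Qed.

End Quadrature.

(** * Sums over words and Gaussian moments *)

Section WordSums.
Variables (I : finType) (V : nmodType).
Implicit Types F : seq I -> V.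

Lemma sum_tuple0 F : \sum_(t : 0.-tuple I) F t = F [::].
Proof. by rewrite (bigD1 [tuple]) //= big1 ?addr0 // => t /eqP[]; apply: tuple0. Qed.

Lemma sum_tupleS m F :
  \sum_(t : m.+1.-tuple I) F t = \sum_c \sum_(t : m.-tuple I) F (c :: t).
Proof.
rewrite pair_bigA /= (reindex (fun p : I * m.-tuple I => [tuple of p.1 :: p.2])) //=.
exists (fun t : m.+1.-tuple I => (thead t, [tuple of behead t])) => [[c t] _|t _] /=.
  by congr (_, _); apply: val_inj.
by rewrite -tuple_eta.
Qed.

Lemma sum_tuple_cat m k F :
  \sum_(t : (m + k).-tuple I) F t =
  \sum_(u : m.-tuple I) \sum_(v : k.-tuple I) F (u ++ v).
Proof.
elim: m F => [|m IH] F; first by rewrite (sum_tuple0 (fun u => \sum_(v : k.-tuple I) F (u ++ v))).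
rewrite addSn sum_tupleS (sum_tupleS _ (fun u => \sum_(v : k.-tuple I) F (u ++ v))); apply: eq_bigr => c _.
by rewrite (IH (fun s => F (c :: s))).
Qed.

End WordSums.

(** Invariance is only required on words of length [m]: shorter or longer words
    are no tensor indices. *)
Definition perm_inv (I : eqType) (A : Type) m (F : seq I -> A) :=
  forall s t, size s = m -> perm_eq s t -> F s = F t.

Section Moments.
Variables (I : finType) (C : numClosedFieldType).
Implicit Types (u v : seq I) (b c : I).

Lemma sum_tuple_delta e (G : seq I -> C) (w : e.-tuple I) :
  \sum_(t : e.-tuple I) (t == w :> seq I)%:R * G t = G w.
Proof.
rewrite (bigD1 w) //= eqxx mul1r big1 ?addr0 // => t /eqP tw.
case: eqP => [/val_inj //|_]; exact: mul0r.
Qed.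

(** By symmetry each of the [m + 1] positions of the letter [b] contributes as
    much as the first one. *)
Lemma sum_count b m (F : seq I -> C) : perm_inv m.+1 F ->
  \sum_(t : m.+1.-tuple I) (count_mem b t)%:R * F t =
  m.+1%:R * \sum_(t : m.-tuple I) F (b :: t).
Proof.
elim: m F => [|m IH] F hF.
  rewrite (sum_tupleS _ (fun s => (count_mem b s)%:R * F s)).
  rewrite (sum_tuple0 (fun s => F (b :: s))) mul1r.
  under eq_bigr => c _ do rewrite (sum_tuple0 (fun s => (count_mem b (c :: s))%:R * F (c :: s))) /=.
  rewrite (bigD1 b) //= eqxx mul1r big1 ?addr0 // => c /negPf cb.
  by rewrite cb mul0r.
rewrite (sum_tupleS _ (fun s => (count_mem b s)%:R * F s)).
under eq_bigr => c _.
  under eq_bigr do rewrite /= natrD mulrDl.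
  rewrite big_split /= -mulr_sumr (IH (fun s => F (c :: s))).
    over.
  by move=> s t ss st; apply: hF; rewrite /= ?ss // perm_cons.
rewrite big_split /= -mulr_sumr -[m.+2%:R]natr1 mulrDl mul1r addrC; congr (_ + _).
  congr (_ * _); rewrite (sum_tupleS _ (fun s => F (b :: s))); apply: eq_bigr => c _; apply: eq_bigr => t _.
  by apply: hF; rewrite ?size_tuple //=  -[[:: c, b & t]]/([:: c] ++ [:: b] ++ t) perm_catCA.
rewrite (bigD1 b) //= eqxx mul1r [X in _ + X]big1 ?addr0 // => c /negPf cb.
by rewrite cb mul0r.
Qed.

(** The Gaussian moment of [conj z^u z^v]: the number of bijections between the
    positions of [u] and those of [v] that preserve letters. *)
Definition moment u v : nat :=
  \prod_c (if count_mem c u == count_mem c v then (count_mem c u)`! else 0).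

Lemma momentC u v : moment u v = moment v u.
Proof. by apply: eq_bigr => c _; rewrite eq_sym; case: eqP => // ->. Qed.

Lemma moment_permr u v w : perm_eq v w -> moment u v = moment u w.
Proof.
by move=> /seq.permP vw; apply: eq_bigr => c _; rewrite (vw (pred1 c)).
Qed.

Lemma moment_cons b u v : moment (b :: u) v = (count_mem b v * moment u (rem b v))%N.
Proof.
rewrite /moment (bigD1 b) //= eqxx [in RHS](bigD1 b) //= mulnA; congr (_ * _)%N; last first.
  apply: eq_bigr => c /negPf cb.
  by rewrite count_mem_rem [b == c]eq_sym cb add0n subn0.
rewrite count_mem_rem eqxx; case: (count_mem b v) => [|k]; first by rewrite add1n.
by rewrite add1n eqSS subn1 /=; case: eqP => [->|_]; rewrite ?factS ?muln0.
Qed.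

Lemma moment_cons_cons b u v : moment (b :: u) (b :: v) = ((count_mem b v).+1 * moment u v)%N.
Proof. by rewrite moment_cons /= eqxx. Qed.

Lemma perm_rem b u v : perm_eq u v -> perm_eq (rem b u) (rem b v).
Proof.
by move=> uv; apply/seq.permP => a; rewrite !count_rem (seq.permP uv) (perm_mem uv).
Qed.

(** Gaussian integration by parts, contracted with a symmetric tensor. *)
Lemma sum_moment_cons b u m (F : seq I -> C) : perm_inv m.+1 F ->
  \sum_(t : m.+1.-tuple I) (moment (b :: u) t)%:R * F t =
  m.+1%:R * \sum_(t : m.-tuple I) (moment u t)%:R * F (b :: t).
Proof.
move=> hF.
under eq_bigr do rewrite moment_cons natrM -mulrA.
rewrite (@sum_count b m (fun t => (moment u (rem b t))%:R * F t)) => [|s t ss st].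
  by congr (_ * _); apply: eq_bigr => t _; rewrite /= eqxx.
by rewrite (hF _ _ ss st) (moment_permr u (perm_rem b st)).
Qed.

Lemma sum_moment m (T : seq I -> seq I -> C) : (forall s, perm_inv m (T s)) ->
  \sum_(s : m.-tuple I) \sum_(t : m.-tuple I) (moment s t)%:R * T s t =
  m`!%:R * \sum_(s : m.-tuple I) T s s.
Proof.
elim: m T => [|m IH] T hT.
  rewrite (sum_tuple0 (fun s => \sum_(t : 0.-tuple I) (moment s t)%:R * T s t)).
  rewrite (sum_tuple0 (fun t => (moment [::] t)%:R * T [::] t)) (sum_tuple0 (fun s => T s s)).
  rewrite /moment big1 ?mul1r // => c _; by rewrite eqxx.
rewrite (sum_tupleS _ (fun s => \sum_(t : m.+1.-tuple I) (moment s t)%:R * T s t)).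
rewrite (sum_tupleS _ (fun s => T s s)) factS natrM -mulrA !mulr_sumr; apply: eq_bigr => c _.
under eq_bigr do rewrite sum_moment_cons //.
rewrite -mulr_sumr (IH (fun s t => T (c :: s) (c :: t))) // => s t v st tv.
by apply: hT; rewrite /= ?st // perm_cons.
Qed.

Lemma moment_cons2 b c u v :
  moment (b :: u) (c :: v) =
  ((b == c) * moment u v + count_mem b v * moment u (c :: rem b v))%N.
Proof.
rewrite moment_cons /=; case: (eqVneq b c) => [->|bc].
  rewrite mulnDl !mul1n; congr (_ + _)%N.
  have [cv|cv] := boolP (c \in v).
    by congr (_ * _)%N; apply/moment_permr/perm_to_rem.
  by rewrite (count_memPn cv) !mul0n.
by [].
Qed.

(** Wick's formula with two letters outside the tensor: either they are matched
    with each other, or each of them is matched with one of the [m] slots on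
    the other side. *)
Lemma sum_moment2 m (T : seq I -> seq I -> C) b c :
  (forall s, perm_inv m (T s)) -> (forall t, perm_inv m (T^~ t)) ->
  \sum_(s : m.-tuple I) \sum_(t : m.-tuple I) (moment (b :: s) (c :: t))%:R * T s t =
  m`!%:R * ((b == c)%:R * (\sum_(s : m.-tuple I) T s s)
            + m%:R * \sum_(u : m.-1.-tuple I) T (c :: u) (b :: u)).
Proof.
move=> hr hl.
under eq_bigr => s _.
  under eq_bigr => t _ do rewrite moment_cons2 natrD !natrM mulrDl -!mulrA.
  rewrite big_split /= -mulr_sumr; over.
rewrite big_split /= -mulr_sumr sum_moment // mulrDr mulrCA; congr (_ + _).
case: m hr hl => [|m] hr hl.
  rewrite mul0r mulr0 (sum_tuple0 (fun s => \sum_(t : 0.-tuple I)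
    (count_mem b t)%:R * ((moment s (c :: rem b t))%:R * T s t))).
  by rewrite (sum_tuple0 (fun t => (count_mem b t)%:R * ((moment [::] (c :: rem b t))%:R * T [::] t))) mul0r.
under eq_bigr => s _.
  rewrite (@sum_count b m (fun t => (moment s (c :: rem b t))%:R * T s t)); last first.
    move=> t v ts tv; rewrite (hr s _ _ ts tv); congr (_%:R * _).
    by apply: moment_permr; rewrite perm_cons perm_rem.
  under eq_bigr do rewrite /= eqxx momentC.
  over.
rewrite -mulr_sumr exchange_big /=.
under eq_bigr => t _ do
  rewrite (@sum_moment_cons c t m (T^~ (b :: t))) //.
rewrite -mulr_sumr (@sum_moment m (fun t s => T (c :: s) (b :: t))).
  by rewrite factS natrM; ring.
by move=> s t v ts tv; apply: hl; rewrite /= ?ts // perm_cons.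
Qed.

Definition mono (z : I -> C) u : C := \prod_(c <- u) z c.

Lemma mono_cat z u v : mono z (u ++ v) = mono z u * mono z v.
Proof. by rewrite /mono big_cat. Qed.

Lemma mono_count z u : mono z u = \prod_c z c ^+ count_mem c u.
Proof.
rewrite /mono; elim: u => [|b u IH]; first by rewrite big_nil big1.
rewrite big_cons IH [in RHS](bigD1 b) //= eqxx exprD expr1 -mulrA; congr (_ * _).
rewrite (bigD1 b) //=; congr (_ * _); apply: eq_bigr => c /negPf cb.
by rewrite eq_sym cb.
Qed.

Definition sqnorm (z : I -> C) : C := \sum_c (z c)^* * z c.

(** Independent coordinates: the moment factors over the letters. *)
Lemma gaussian_average n : exists (P : finType) (W : P -> C) (Z : P -> I -> C),
  (forall p, 0 <= W p) /\
  forall u v, (size u <= n)%N -> (size v <= n)%N ->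
    \sum_p W p * ((mono (Z p) u)^* * mono (Z p) v) = (moment u v)%:R.
Proof.
have [K [w [z [w0 wz]]]] := gaussian_quadrature C n.
exists {ffun I -> K}, (fun p : {ffun I -> K} => \prod_c w (p c)), (fun (p : {ffun I -> K}) c => z (p c)).
split=> [p|u v un vn]; first by apply: prodr_ge0 => c _; exact: w0.
transitivity (\sum_(p : {ffun I -> K})
    \prod_c (w (p c) * ((z (p c))^* ^+ count_mem c u * z (p c) ^+ count_mem c v))).
  apply: eq_bigr => p _; rewrite !mono_count rmorph_prod -!big_split /=.
  by apply: eq_bigr => c _; rewrite rmorphXn.
pose G c k := w k * ((z k)^* ^+ count_mem c u * z k ^+ count_mem c v).
have GE : \prod_c \sum_k G c k = \sum_(p : {ffun I -> K}) \prod_c G c (p c) by exact: bigA_distr_bigA.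
rewrite -[LHS]GE.
rewrite /moment natr_prod; apply: eq_bigr => c _.
rewrite /G (wz (count_mem c u) (count_mem c v)); last 2 first.
- exact: leq_trans (count_size _ _) un.
- exact: leq_trans (count_size _ _) vn.
by case: ifP => _; [exact: mul1r | exact: mul0r].
Qed.

Lemma count_sum v : (\sum_c count_mem c v = size v)%N.
Proof.
elim: v => [|b v IH]; first exact: big1.
rewrite [RHS]/= -add1n -IH.
transitivity (\sum_c (b == c) + \sum_c count_mem c v)%N; first exact: big_split.
congr (_ + _)%N; rewrite (bigD1 b) //= eqxx big1 // => c /negPf cb.
by rewrite eq_sym cb.
Qed.

(** Each factor [|z|^2] adds one common letter to both words; summing the
    resulting multiplicities gives the factor [#|I| + size u + i]. *)
Lemma average_sqnorm (P : finType) (W : P -> C) (Z : P -> I -> C) n :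
  (forall u v, (size u <= n)%N -> (size v <= n)%N ->
    \sum_p W p * ((mono (Z p) u)^* * mono (Z p) v) = (moment u v)%:R) ->
  forall j u v, (size u + j <= n)%N -> size v = size u ->
    \sum_p W p * (sqnorm (Z p) ^+ j * ((mono (Z p) u)^* * mono (Z p) v)) =
    (\prod_(i < j) (#|I| + size u + i))%:R * (moment u v)%:R.
Proof.
move=> hW; elim=> [|j IH] u v un vu.
  move: un; rewrite addn0 big_ord0 mul1r => un; rewrite -hW ?vu //.
  by apply: eq_bigr => p _; rewrite expr0 mul1r.
transitivity (\sum_c \sum_p W p * (sqnorm (Z p) ^+ j *
   ((mono (Z p) (c :: u))^* * mono (Z p) (c :: v)))).
  rewrite exchange_big; apply: eq_bigr => p _ /=.
  rewrite -!mulr_sumr exprSr -mulrA [in LHS]/sqnorm mulr_suml; congr (_ * (_ * _)).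
  by apply: eq_bigr => c _; rewrite /mono !big_cons rmorphM /=; ring.
under eq_bigr => c _ do rewrite IH /= ?vu ?addSnnS // moment_cons_cons natrM mulrA.
rewrite -mulr_suml -mulr_sumr -natr_sum -natrM; congr (_%:R * _).
rewrite (_ : \sum_c _ = #|I| + size u)%N; last first.
  under eq_bigr do rewrite -addn1.
  by rewrite big_split /= count_sum sum1_card vu addnC.
rewrite big_ord_recl addn0 mulnC; congr (_ * _)%N.
by apply: eq_bigr => i _; rewrite addnS addSnnS.
Qed.

End Moments.

(** * Averaging a symmetric tensor against a polynomial kernel *)

Lemma sum_tuple_dim (I : finType) (V : nmodType) m m' (F : seq I -> V) : m = m' ->
  \sum_(t : m.-tuple I) F t = \sum_(t : m'.-tuple I) F t.
Proof. by move->. Qed.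

(** Reordering in one step: exchanging neighbouring sums would take many. *)
Lemma sum6_perm (V : nmodType) (A1 A2 A3 A4 A5 A6 : finType)
  (F : A1 -> A2 -> A3 -> A4 -> A5 -> A6 -> V) :
  \sum_a \sum_b \sum_c \sum_d \sum_e \sum_f F a b c d e f =
  \sum_d \sum_b \sum_e \sum_a \sum_f \sum_c F a b c d e f.
Proof.
pose G := fun x : A1 * A2 * A3 * A4 * A5 * A6 =>
  let: (a, b, c, d, e, f) := x in F a b c d e f.
transitivity (\sum_x G x).
  by do 5! rewrite pair_bigA /=; apply: eq_bigr => -[[[[[a b] c] d] e] f] _.
pose h := fun x : A4 * A2 * A5 * A1 * A6 * A3 =>
  let: (d, b, e, a, f, c) := x in (a, b, c, d, e, f).
rewrite (reindex h) /=; last first.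
  exists (fun x : A1 * A2 * A3 * A4 * A5 * A6 =>
    let: (a, b, c, d, e, f) := x in (d, b, e, a, f, c)).
    by move=> [[[[[d b] e] a] f] c].
  by move=> [[[[[a b] c] d] e] f].
by do 5! rewrite pair_bigA /=; apply: eq_bigr => -[[[[[d b] e] a] f] c] _.
Qed.

Section Kernel.
Variables (I : finType) (C : numClosedFieldType) (N e : nat) (c : nat -> C).
Hypothesis c_real : forall k, (c k)^* = c k.
Implicit Types (z : I -> C) (T : seq I -> seq I -> C).

Lemma sqnorm_ge0 z : 0 <= sqnorm z.
Proof. by apply: sumr_ge0 => b _; rewrite mulrC mul_conjC_ge0. Qed.

(** Paired with [y] on the first [N] slots, conjugated, and on the next [N] slots
    it is [sum_k c_k |z|^{2(N-k)} |<z,y>|^{2k} |y|^{2(N-k)}]: slot [i] of [u] goes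
    with slot [i] of [v], the first [k] pairs being contracted with [z] and the
    others with each other. *)
Definition kvec z (u v : seq I) : C :=
  \sum_(k < N.+1) c k * sqnorm z ^+ (N - k) *
    ((drop k u == drop k v)%:R * ((mono z (take k u))^* * mono z (take k v))).

Lemma sum_drop_eq k (G : seq I -> seq I -> C) : (k <= N)%N ->
  \sum_(u : N.-tuple I) \sum_(v : N.-tuple I) (drop k u == drop k v)%:R * G u v =
  \sum_(p : k.-tuple I) \sum_(q : k.-tuple I) \sum_(r : (N - k).-tuple I) G (p ++ r) (q ++ r).
Proof.
move=> kN; pose H u v : C := (drop k u == drop k v)%:R * G u v.
transitivity (\sum_(u : (k + (N - k)).-tuple I) \sum_(v : (k + (N - k)).-tuple I) H u v).
  by rewrite (subnKC kN).
rewrite (sum_tuple_cat _ _ (fun u => \sum_(v : (k + (N - k)).-tuple I) H u v)).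
apply: eq_bigr => p _.
under eq_bigr => r _ do rewrite (sum_tuple_cat _ _ (H (p ++ r))).
rewrite exchange_big /=; apply: eq_bigr => q _; apply: eq_bigr => r _.
rewrite (bigD1 r) //= /H !drop_size_cat ?size_tuple // eqxx mul1r big1 ?addr0 // => s sr.
rewrite drop_size_cat ?size_tuple //; case: eqP => [/val_inj rs|_]; last exact: mul0r.
by rewrite rs eqxx in sr.
Qed.

Lemma sum_kvec z (G : seq I -> seq I -> C) :
  \sum_(u : N.-tuple I) \sum_(v : N.-tuple I) kvec z u v * G u v =
  \sum_(k < N.+1) c k * sqnorm z ^+ (N - k) *
    \sum_(p : k.-tuple I) \sum_(q : k.-tuple I) \sum_(r : (N - k).-tuple I)
      ((mono z p)^* * mono z q) * G (p ++ r) (q ++ r).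
Proof.
transitivity (\sum_(u : N.-tuple I) \sum_(k < N.+1) \sum_(v : N.-tuple I)
    c k * sqnorm z ^+ (N - k) * ((drop k u == drop k v)%:R *
      ((mono z (take k u))^* * mono z (take k v) * G u v))).
  apply: eq_bigr => u _; rewrite exchange_big /=; apply: eq_bigr => v _.
  by rewrite /kvec mulr_suml; apply: eq_bigr => k _; rewrite -!mulrA.
rewrite exchange_big /=; apply: eq_bigr => k _.
under eq_bigr => u _ do rewrite -mulr_sumr.
rewrite -mulr_sumr; congr (_ * _).
rewrite (@sum_drop_eq k (fun u v => (mono z (take k u))^* * mono z (take k v) * G u v)) //;
  last by rewrite -ltnS.
apply: eq_bigr => p _; apply: eq_bigr => q _; apply: eq_bigr => r _.
by rewrite !take_size_cat ?size_tuple.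
Qed.

Lemma sum_kvec_conj z (G : seq I -> seq I -> C) :
  \sum_(u : N.-tuple I) \sum_(v : N.-tuple I) (kvec z u v)^* * G u v =
  \sum_(k < N.+1) c k * sqnorm z ^+ (N - k) *
    \sum_(p : k.-tuple I) \sum_(q : k.-tuple I) \sum_(r : (N - k).-tuple I)
      (mono z p * (mono z q)^*) * G (p ++ r) (q ++ r).
Proof.
have := congr1 (fun x : C => x^*) (sum_kvec z (fun u v => (G u v)^*)).
rewrite !rmorph_sum /= => h; transitivity (\sum_(u : N.-tuple I)
  (\sum_(v : N.-tuple I) kvec z u v * (G u v)^*)^*).
  apply: eq_bigr => u _; rewrite rmorph_sum; apply: eq_bigr => v _.
  by rewrite rmorphM /= conjCK.
rewrite h; apply: eq_bigr => k _; rewrite !rmorphM /= c_real rmorphXn /=.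
rewrite [X in _ * X ^+ _ * _]conj_Creal ?ger0_real ?sqnorm_ge0 //; congr (_ * _).
do 3! (rewrite rmorph_sum; apply: eq_bigr => ? _).
by rewrite !rmorphM /= !conjCK.
Qed.

Definition tail_trace T j : seq I -> seq I -> C :=
  fun s t => \sum_(w : j.-tuple I) T (s ++ w) (t ++ w).

Definition eval_words z m T : C :=
  \sum_(s : m.-tuple I) \sum_(t : m.-tuple I) ((mono z s)^* * mono z t) * T s t.

(** The partial transposition shows as the exchange of [u] and [v] between the
    two arguments of [T]. *)
Definition pairing z T : C :=
  \sum_(u : N.-tuple I) \sum_(u' : N.-tuple I) (kvec z u u')^* *
    \sum_(v : N.-tuple I) \sum_(v' : N.-tuple I) kvec z v v' *
      \sum_(w : e.-tuple I) T (v ++ u' ++ w) (u ++ v' ++ w).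

Let l := (N + (N + e))%N.

(** After the exchange, the slots contracted with [z] on either side of [T] are
    [k' + k] in number, and all other slots are traced; the symmetry of [T]
    allows to list the former first.  The square of the polynomial thus appears
    as a sum over pairs of exponents. *)
Lemma pairingE z T :
  (forall s, perm_inv l (T s)) -> (forall t, perm_inv l (T^~ t)) ->
  pairing z T = \sum_(k < N.+1) \sum_(k' < N.+1) c k * c k' *
    (sqnorm z ^+ ((N - k) + (N - k')) *
      eval_words z (k' + k) (tail_trace T (l - (k' + k)))).
Proof.
move=> hr hl; rewrite /pairing.
under eq_bigr => u _ do under eq_bigr => u' _ do
  rewrite (sum_kvec z (fun v v' => \sum_(w : e.-tuple I) T (v ++ u' ++ w) (u ++ v' ++ w))).
pose G u u' := \sum_(k < N.+1) c k * sqnorm z ^+ (N - k) *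
    \sum_(p : k.-tuple I) \sum_(q : k.-tuple I) \sum_(r : (N - k).-tuple I)
      ((mono z p)^* * mono z q) *
      \sum_(w : e.-tuple I) T ((p ++ r) ++ u' ++ w) (u ++ (q ++ r) ++ w).
rewrite (sum_kvec_conj z G); apply: eq_bigr => k _.
have kN : (k <= N)%N by rewrite -ltnS.
pose H p q r k' : C := \sum_(p' : k'.-tuple I) \sum_(q' : k'.-tuple I)
   \sum_(r' : (N - k').-tuple I) ((mono z p')^* * mono z q') *
      \sum_(w : e.-tuple I) T ((p' ++ r') ++ (q ++ r) ++ w) ((p ++ r) ++ (q' ++ r') ++ w).
transitivity (\sum_(k' < N.+1) c k * sqnorm z ^+ (N - k) * (c k' * sqnorm z ^+ (N - k') *
  \sum_(p : k.-tuple I) \sum_(q : k.-tuple I) \sum_(r : (N - k).-tuple I)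
      (mono z p * (mono z q)^*) * H p q r k')).
  rewrite -mulr_sumr; congr (_ * _).
  under [RHS]eq_bigr => k' _ do rewrite mulr_sumr.
  rewrite [RHS]exchange_big /=; apply: eq_bigr => p _.
  under [RHS]eq_bigr => k' _ do rewrite mulr_sumr.
  rewrite [RHS]exchange_big /=; apply: eq_bigr => q _.
  under [RHS]eq_bigr => k' _ do rewrite mulr_sumr.
  rewrite [RHS]exchange_big /=; apply: eq_bigr => r _.
  rewrite /G mulr_sumr; apply: eq_bigr => k' _.
  by rewrite mulrCA.
apply: eq_bigr => k' _; rewrite exprD -!mulrA; congr (_ * _).
rewrite [LHS]mulrCA; congr (_ * (_ * (_ * _))).
have k'N : (k' <= N)%N by rewrite -ltnS.
pose F (p q : k.-tuple I) (r : (N - k).-tuple I) (p' q' : k'.-tuple I)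
  (r' : (N - k').-tuple I) : C :=
  ((mono z (p' ++ q))^* * mono z (q' ++ p)) *
  \sum_(w : e.-tuple I) T ((p' ++ q) ++ r' ++ r ++ w) ((q' ++ p) ++ r' ++ r ++ w).
transitivity (\sum_p \sum_q \sum_r \sum_p' \sum_q' \sum_r' F p q r p' q' r').
  apply: eq_bigr => p _; apply: eq_bigr => q _; apply: eq_bigr => r _.
  rewrite /H mulr_sumr; apply: eq_bigr => p' _.
  rewrite mulr_sumr; apply: eq_bigr => q' _.
  rewrite mulr_sumr; apply: eq_bigr => r' _.
  rewrite mulrA /F !mono_cat rmorphM /=; congr (_ * _); first by ring.
  apply: eq_bigr => w _.
  have sz (a b : k'.-tuple I) (a' b' : k.-tuple I) :
      size (((a ++ r') ++ (b' ++ r) ++ w)) = l.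
    by rewrite !size_cat !size_tuple /l; lia.
  have sz' (a b : k'.-tuple I) (a' b' : k.-tuple I) :
      size (((a' ++ r) ++ (b ++ r') ++ w)) = l.
    by rewrite !size_cat !size_tuple /l; lia.
  rewrite (hl _ _ ((p' ++ q) ++ r' ++ r ++ w) (sz p' p' q q)); last first.
    by apply/seq.permP => a; rewrite !count_cat; lia.
  by apply: hr (sz' q' q' p p) _; apply/seq.permP => a; rewrite !count_cat; lia.
rewrite sum6_perm /eval_words.
rewrite (sum_tuple_cat _ _ (fun s => \sum_(t : (k' + k).-tuple I)
   (mono z s)^* * mono z t * tail_trace T (l - (k' + k)) s t)).
apply: eq_bigr => p' _; apply: eq_bigr => q _.
rewrite (sum_tuple_cat _ _ (fun t =>
   (mono z (p' ++ q))^* * mono z t * tail_trace T (l - (k' + k)) (p' ++ q) t)).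
apply: eq_bigr => q' _; apply: eq_bigr => p _.
rewrite /F; under eq_bigr => r' _ do rewrite -mulr_sumr.
rewrite -mulr_sumr; congr (_ * _).
rewrite /tail_trace.
pose Q w := T ((p' ++ q) ++ w) ((q' ++ p) ++ w).
rewrite (@sum_tuple_dim _ _ _ ((N - k') + ((N - k) + e)) Q); last by rewrite /l; lia.
rewrite (sum_tuple_cat _ _ Q); apply: eq_bigr => r' _.
by rewrite (sum_tuple_cat _ _ (fun w => Q (r' ++ w))).
Qed.

Section Average.
Variables (P : finType) (W : P -> C) (Z : P -> I -> C).
Hypothesis hW : forall u v, (size u <= (N + N).+1)%N -> (size v <= (N + N).+1)%N ->
  \sum_p W p * ((mono (Z p) u)^* * mono (Z p) v) = (moment u v)%:R.

Lemma prod_succ_fact a j : ((\prod_(i < j) (a + i).+1) * a`! = (a + j)`!)%N.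
Proof.
elim: j => [|j IH]; first by rewrite big_ord0 mul1n addn0.
by rewrite big_ord_recr /= mulnAC IH addnS factS mulnC.
Qed.

(** Homogeneity: whatever [m] is, the monomials have degree [2 N + 1] in [z] and
    in its conjugate, hence the common factor [(2 N + #|I|)!]. *)
Lemma average_eval_words T m b b' : (m <= N + N)%N ->
  (forall s, perm_inv m (T s)) -> (forall t, perm_inv m (T^~ t)) ->
  \sum_p W p * (sqnorm (Z p) ^+ (N + N - m) * eval_words (Z p) m T *
                ((Z p b)^* * Z p b')) =
  (N + N + #|I|)`!%:R / (m + #|I|)`!%:R * m`!%:R *
    ((b == b')%:R * (\sum_(s : m.-tuple I) T s s)
       + m%:R * \sum_(u : m.-1.-tuple I) T (b' :: u) (b :: u)).
Proof.
move=> mN hr hl; set j := (N + N - m)%N.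
transitivity (\sum_(s : m.-tuple I) \sum_(t : m.-tuple I) (\sum_p W p *
   (sqnorm (Z p) ^+ j * ((mono (Z p) (b :: s))^* * mono (Z p) (b' :: t)))) * T s t).
  under [RHS]eq_bigr => s _ do under eq_bigr => t _ do rewrite mulr_suml.
  under [RHS]eq_bigr => s _ do rewrite exchange_big /=.
  rewrite [RHS]exchange_big /=; apply: eq_bigr => p _.
  rewrite /eval_words !(mulr_sumr, mulr_suml); apply: eq_bigr => s _.
  rewrite !(mulr_sumr, mulr_suml); apply: eq_bigr => t _.
  by rewrite /mono !big_cons rmorphM /=; ring.
transitivity ((\prod_(i < j) (m + #|I| + i).+1)%:R * \sum_(s : m.-tuple I) \sum_(t : m.-tuple I)
   (moment (b :: s) (b' :: t))%:R * T s t).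
  rewrite mulr_sumr; apply: eq_bigr => s _; rewrite mulr_sumr; apply: eq_bigr => t _.
  rewrite (average_sqnorm hW) /= ?size_tuple //; last by rewrite /j; lia.
  rewrite mulrA; congr (_%:R * _ * _); apply: eq_bigr => i _; lia.
rewrite sum_moment2 // mulrA; congr (_ * _ * _).
apply: (mulIf (_ : (m + #|I|)`!%:R != 0)); first by rewrite pnatr_eq0 -lt0n fact_gt0.
rewrite -natrM prod_succ_fact mulfVK ?pnatr_eq0 -?lt0n ?fact_gt0 //.
by congr (_`!%:R); rewrite /j; lia.
Qed.

Lemma pairing_average T b b' :
  (forall s, perm_inv l (T s)) -> (forall t, perm_inv l (T^~ t)) ->
  \sum_p W p * (pairing (Z p) T * ((Z p b)^* * Z p b')) =
  \sum_(k < N.+1) \sum_(k' < N.+1) c k * c k' *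
    ((N + N + #|I|)`!%:R / (k' + k + #|I|)`!%:R * (k' + k)`!%:R *
    ((b == b')%:R * (\sum_(s : l.-tuple I) T s s)
       + (k' + k)%:R * \sum_(u : l.-1.-tuple I) T (b' :: u) (b :: u))).
Proof.
move=> hr hl.
transitivity (\sum_(k < N.+1) \sum_(k' < N.+1) c k * c k' *
  \sum_p W p * (sqnorm (Z p) ^+ (N + N - (k' + k)) *
    eval_words (Z p) (k' + k) (tail_trace T (l - (k' + k))) * ((Z p b)^* * Z p b'))).
  under [RHS]eq_bigr => k _ do under eq_bigr => k' _ do rewrite mulr_sumr.
  under [RHS]eq_bigr => k _ do rewrite exchange_big /=.
  rewrite [RHS]exchange_big /=; apply: eq_bigr => p _.
  rewrite pairingE // !(mulr_sumr, mulr_suml); apply: eq_bigr => k _.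
  rewrite !(mulr_sumr, mulr_suml); apply: eq_bigr => k' _.
  have -> : (N - k + (N - k') = N + N - (k' + k))%N.
    by have := ltn_ord k; have := ltn_ord k'; lia.
  ring.
apply: eq_bigr => k _; apply: eq_bigr => k' _; congr (_ * _).
set m := (k' + k)%N.
have mN : (m <= N + N)%N by have := ltn_ord k; have := ltn_ord k'; rewrite /m; lia.
have ml : (m <= l)%N by rewrite /l; lia.
rewrite average_eval_words //; first last.
- move=> t s s' ss ss'; apply: eq_bigr => w _; apply: hl; last by rewrite perm_cat2r.
  by rewrite size_cat size_tuple ss subnKC.
- move=> t s s' ss ss'; apply: eq_bigr => w _; apply: hr; last by rewrite perm_cat2r.
  by rewrite size_cat size_tuple ss subnKC.
congr (_ * (_ * _ + _)).
  rewrite -(sum_tuple_cat _ _ (fun s => T s s)).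
  by apply: (sum_tuple_dim (fun s => T s s)); rewrite subnKC.
case: m mN ml => [|m] mN ml; first by rewrite !mul0r.
congr (_ * _); rewrite -(sum_tuple_cat _ _ (fun s => T (b' :: s) (b :: s))).
by apply: (sum_tuple_dim (fun s => T (b' :: s) (b :: s))); lia.
Qed.

End Average.
End Kernel.

(** * Operators on the extended space *)

Section Matrices.
Variable R : realType.
Local Notation C := (R[i]).

Lemma sum_mxtens m n (V : nmodType) (F : 'I_(m * n) -> V) :
  \sum_k F k = \sum_a \sum_b F (mxtens_index (a, b)).
Proof.
rewrite pair_bigA /=; apply: (reindex (fun p => mxtens_index (p.1, p.2))).
exists (@mxtens_unindex m n) => [[a b] _|k _]; first by rewrite mxtens_indexK.
by rewrite -surjective_pairing mxtens_unindexK.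
Qed.

Lemma qformE n (A : 'M[C]_n) v :
  qform A v = \sum_i \sum_j (v i 0)^* * v j 0 * A i j.
Proof.
rewrite /qform mxE exchange_big /=; apply: eq_bigr => j _.
rewrite mxE mulr_suml; apply: eq_bigr => i _.
by rewrite !mxE mulrAC.
Qed.

Lemma hermsymmxE n (A : 'M[C]_n) : A \is hermsymmx -> forall i j, A i j = (A j i)^*.
Proof.
move=> /is_hermitianmxP; rewrite expr0 scale1r => h i j.
by rewrite {1}h !mxE.
Qed.

Lemma hermsymmxI n (A : 'M[C]_n) : (forall i j, A i j = (A j i)^*) -> A \is hermsymmx.
Proof.
move=> h; apply/is_hermitianmxP; rewrite expr0 scale1r; apply/matrixP => i j.
by rewrite h !mxE.
Qed.

(** In an eigenbasis of [B] the trace is a sum of products of nonnegative diagonal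
    entries. *)
Lemma trace_mul_ge0 n (A B : 'M[C]_n) :
  (forall v, 0 <= qform A v) -> psd B -> 0 <= \tr (A *m B).
Proof.
move=> hA [hB qB].
have /orthomx_spectralP : B \is normalmx by apply: hermitian_normalmx.
set P := spectralmx B; set D := spectral_diag B => eB.
have PU : P \is unitarymx by apply: spectral_unitarymx.
have invP := invmx_unitary PU.
have /unitarymxP PP := PU.
have D0 j : 0 <= D 0 j.
  have -> : D 0 j = (P *m B *m P^t*) j j.
    by rewrite eB invP !mulmxA PP mul1mx -mulmxA PP mulmx1 mxE eqxx.
  suff -> : (P *m B *m P^t*) j j = qform B ((row j P)^t*) by apply: qB.
  rewrite /qform trmxCK; rewrite !mxE; apply: eq_bigr => k _.
  by rewrite -row_mul !mxE.
have -> : \tr (A *m B) = \tr (P *m A *m P^t* *m diag_mx D).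
  by rewrite eB invP !mulmxA mxtrace_mulC !mulmxA.
rewrite /mxtrace sumr_ge0 // => j _.
rewrite mul_mx_diag mxE mulr_ge0 //.
suff -> : (P *m A *m P^t*) j j = qform A ((row j P)^t*) by apply: hA.
rewrite /qform trmxCK !mxE; apply: eq_bigr => k _.
by rewrite -row_mul !mxE.
Qed.

Section Words.
Variables (d l : nat) (i0 : 'I_d).
Local Notation idx := {ffun 'I_l -> 'I_d}.
Local Notation dimB := #|{: idx}|.

Definition word_index (s : seq 'I_d) : idx := [ffun i : 'I_l => nth i0 s i].

Lemma word_index_codom s : size s = l -> codom (word_index s) = s.
Proof.
move=> ss; apply: (@eq_from_nth _ i0); rewrite size_codom card_ord // => i il.
have il' : (i < size (enum 'I_l))%N by rewrite size_enum_ord.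
rewrite codomE (nth_map (Ordinal il)) // ffunE nth_enum_ord //.
Qed.

Lemma codom_word_index (f : idx) : word_index (codom f) = f.
Proof.
apply/ffunP => i; rewrite ffunE codomE.
by rewrite (nth_map i) ?size_enum_ord // nth_ord_enum.
Qed.

Lemma sum_word_index (V : nmodType) (F : idx -> V) :
  \sum_f F f = \sum_(t : l.-tuple 'I_d) F (word_index t).
Proof.
have szc (f : idx) : size (codom f) == l by rewrite size_codom card_ord.
rewrite (reindex (fun t : l.-tuple 'I_d => word_index t)) //.
exists (fun f => Tuple (szc f)) => [t _|f _]; last exact: codom_word_index.
by apply: val_inj; rewrite /= word_index_codom // size_tuple.
Qed.

(** Two rearrangements of a word differ by a permutation of the tensor factors. *)
Lemma perm_word_index s t : size s = l -> perm_eq s t ->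
  exists p : 'S_l, word_index t = [ffun i => word_index s (p i)].
Proof.
move=> ss st; have tt : size t = l by rewrite -(perm_size st).
have szs : size s == l by rewrite ss.
have szt : size t == l by rewrite tt.
have /tuple_permP[p e] : perm_eq (Tuple szt) (Tuple szs) by rewrite perm_sym.
exists p; apply/ffunP => i; rewrite !ffunE.
have := congr1 (fun u => nth i0 u i) e; rewrite /= => ->.
rewrite (nth_map i) ?size_enum_ord // nth_ord_enum.
by rewrite (tnth_nth i0).
Qed.

Lemma sum_ix (V : nmodType) (F : 'I_(d * dimB) -> V) :
  \sum_k F k = \sum_a \sum_(t : l.-tuple 'I_d) F (ix a (word_index t)).
Proof.
rewrite sum_mxtens; apply: eq_bigr => a _.
rewrite -(sum_word_index (fun f => F (ix a f))).
by rewrite (reindex (@enum_rank idx)) //; exists enum_val => k _; rewrite ?enum_rankK ?enum_valK.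
Qed.

Variables (X : 'M[C]_(d * dimB)) (P : 'M[C]_dimB).
Hypotheses (hP : orthoprojector (@sym_subspace R d l) P)
           (hX : (1%:M *t P) *m X *m (1%:M *t P) = X)
           (Xherm : X \is hermsymmx).

Definition word_mx (a a' : 'I_d) (s t : seq 'I_d) : C :=
  X (ix a (word_index s)) (ix a' (word_index t)).

(** [1 (x) P] fixes [X], so that each column of [X] lies in the symmetric
    subspace. *)
Lemma word_mx_perml a a' t : perm_inv l (fun s => word_mx a a' s t).
Proof.
move=> s s' ss /(perm_word_index ss)[p sp]; rewrite /word_mx.
set j := ix a' _.
case: hP => PP _ PV.
have QX : (1%:M *t P) *m X = X.
  by rewrite -{1}hX !mulmxA tensmx_mul mulmx1 PP hX.
pose v : 'cV[C]_dimB := \col_k X (mxtens_index (a, k)) j.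
have : sym_subspace v.
  apply/PV; apply/matrixP => k t0; rewrite !mxE.
  rewrite -[in RHS]QX mxE sum_mxtens (bigD1 a) //= [X in _ + X]big1 ?addr0.
    by apply: eq_bigr => k' _; rewrite tensmxE !mxE eqxx mul1r.
  move=> b /negPf ba; apply: big1 => k' _.
  by rewrite tensmxE !mxE eq_sym ba !mul0r.
move=> /(_ p) /matrixP /(_ (enum_rank (word_index s)) 0).
by rewrite !mxE enum_rankK -sp => <-.
Qed.

Lemma word_mx_permr a a' s : perm_inv l (word_mx a a' s).
Proof.
move=> t t' ts tt'; rewrite /word_mx hermsymmxE // [RHS]hermsymmxE //.
by congr (_^*); apply: (word_mx_perml a' a s ts tt').
Qed.

End Words.

Section Extension.
Variables (d N e : nat) (i0 : 'I_d).
Local Notation l := (N + (N + e))%N.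
Local Notation idx := {ffun 'I_l -> 'I_d}.
Local Notation dimB := #|{: idx}|.
Variables (X : 'M[C]_(d * dimB)) (c : nat -> C).
Hypothesis c_real : forall k, (c k)^* = c k.

Lemma first_of_word_index u u' w v v' w' :
  size u = N -> size u' = N -> size v = N -> size v' = N ->
  first_of N (word_index l i0 (u ++ u' ++ w)) (word_index l i0 (v ++ v' ++ w')) =
  word_index l i0 (v ++ u' ++ w).
Proof.
move=> su su' sv sv'; apply/ffunP => i; rewrite !ffunE !nth_cat su sv.
by case: ltnP.
Qed.

(** The last [e] systems, left over when [2 N < l], are set to the basis vector
    [w]; summing over [w] traces them out. *)
Definition test_vector z (x : 'I_d -> C) (w : seq 'I_d) : 'cV[C]_(d * dimB) :=
  \col_k (x (ix_fst k) * (kvec N c z (take N (codom (ix_snd k)))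
             (take N (drop N (codom (ix_snd k)))) *
          (drop N (drop N (codom (ix_snd k))) == w)%:R)).

Lemma test_vectorE z x w a u v w' : size u = N -> size v = N -> size w' = e ->
  test_vector z x w (ix a (word_index l i0 (u ++ v ++ w'))) 0 =
  x a * (kvec N c z u v * (w' == w)%:R).
Proof.
move=> su sv sw; rewrite mxE /ix_fst /ix_snd mxtens_indexK /= enum_rankK.
rewrite word_index_codom ?size_cat ?su ?sv ?sw //.
by rewrite take_size_cat // drop_size_cat // take_size_cat // drop_size_cat.
Qed.

Lemma sum_words3 (V : nmodType) (F : seq 'I_d -> V) :
  \sum_(t : l.-tuple 'I_d) F t =
  \sum_(u : N.-tuple 'I_d) \sum_(v : N.-tuple 'I_d) \sum_(w : e.-tuple 'I_d) F (u ++ v ++ w).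
Proof.
rewrite sum_tuple_cat; apply: eq_bigr => u _.
by rewrite (sum_tuple_cat _ _ (fun s => F (u ++ s))).
Qed.

Lemma qform_test_vector z x w : size w = e ->
  qform (ptranspose N X) (test_vector z x w) =
  \sum_a \sum_a' (x a)^* * x a' *
    \sum_(u : N.-tuple 'I_d) \sum_(u' : N.-tuple 'I_d) (kvec N c z u u')^* *
      \sum_(v : N.-tuple 'I_d) \sum_(v' : N.-tuple 'I_d) kvec N c z v v' *
        word_mx i0 X a a' (v ++ u' ++ w) (u ++ v' ++ w).
Proof.
move=> sw; have sw' : size w == e by rewrite sw.
rewrite qformE (sum_ix i0); apply: eq_bigr => a _.
pose G a' (s t : seq 'I_d) := (test_vector z x w (ix a (word_index l i0 s)) 0)^* *
  test_vector z x w (ix a' (word_index l i0 t)) 0 *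
  ptranspose N X (ix a (word_index l i0 s)) (ix a' (word_index l i0 t)).
transitivity (\sum_(s : l.-tuple 'I_d) \sum_a' \sum_(t : l.-tuple 'I_d) G a' s t).
  by apply: eq_bigr => s _; rewrite (sum_ix i0).
rewrite exchange_big /=; apply: eq_bigr => a' _.
rewrite (sum_words3 (fun s => \sum_(t : l.-tuple 'I_d) G a' s t)) mulr_sumr.
apply: eq_bigr => u _; rewrite mulr_sumr; apply: eq_bigr => u' _.
pose K u u' v v' w1 w2 : C := word_mx i0 X a a' (v ++ u' ++ w1) (u ++ v' ++ w2).
transitivity (\sum_(w1 : e.-tuple 'I_d) (w1 == w :> seq 'I_d)%:R * (
   \sum_(v : N.-tuple 'I_d) \sum_(v' : N.-tuple 'I_d) \sum_(w2 : e.-tuple 'I_d)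
   (w2 == w :> seq 'I_d)%:R *
   ((x a)^* * x a' * ((kvec N c z u u')^* * (kvec N c z v v' *
   word_mx i0 X a a' (v ++ u' ++ w1) (u ++ v' ++ w2)))))).
  apply: eq_bigr => w1 _; rewrite (sum_words3 (G a' (u ++ u' ++ w1))) mulr_sumr.
  apply: eq_bigr => v _; rewrite mulr_sumr; apply: eq_bigr => v' _.
  rewrite mulr_sumr; apply: eq_bigr => w2 _.
  rewrite /G !test_vectorE ?size_tuple // !rmorphM /= rmorph_nat.
  rewrite /word_mx [ptranspose _ _ _ _]mxE /ix_fst /ix_snd !mxtens_indexK /= !enum_rankK.
  by rewrite !first_of_word_index ?size_tuple //; ring.
pose G1 w1 := \sum_(v : N.-tuple 'I_d) \sum_(v' : N.-tuple 'I_d) \sum_(w2 : e.-tuple 'I_d)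
   (w2 == w :> seq 'I_d)%:R *
   ((x a)^* * x a' * ((kvec N c z u u')^* * (kvec N c z v v' *
   word_mx i0 X a a' (v ++ u' ++ w1) (u ++ v' ++ w2)))).
rewrite (sum_tuple_delta G1 (Tuple sw')) /G1 /=.
rewrite !mulr_sumr; apply: eq_bigr => v _.
rewrite !mulr_sumr; apply: eq_bigr => v' _.
by rewrite (sum_tuple_delta (fun w2 => (x a)^* * x a' * ((kvec N c z u u')^* * (kvec N c z v v' *
   word_mx i0 X a a' (v ++ u' ++ w) (u ++ v' ++ w2)))) (Tuple sw')).
Qed.

Definition pairing_mx z : 'M[C]_d :=
  \matrix_(a, a') pairing N e c z (word_mx i0 X a a').

(** [kvec] treats the first [N] systems as conjugate: partial transposition on
    exactly these makes the quadratic form the contraction [pairing]. *)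
Lemma pairing_mx_ge0 z : psd (ptranspose N X) -> forall v, 0 <= qform (pairing_mx z) v.
Proof.
move=> [_ hX] v.
suff -> : qform (pairing_mx z) v =
  \sum_(w : e.-tuple 'I_d) qform (ptranspose N X) (test_vector z (fun a => v a 0) w).
  by apply: sumr_ge0.
under [RHS]eq_bigr => w _ do rewrite qform_test_vector ?size_tuple //.
rewrite qformE [RHS]exchange_big /=; apply: eq_bigr => a _.
rewrite [RHS]exchange_big /=; apply: eq_bigr => a' _.
rewrite -mulr_sumr mxE /pairing; congr (_ * _).
rewrite [RHS]exchange_big /=; apply: eq_bigr => u _.
rewrite [RHS]exchange_big /=; apply: eq_bigr => u' _.
rewrite -mulr_sumr; congr (_ * _).
rewrite [RHS]exchange_big /=; apply: eq_bigr => w _.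
rewrite [RHS]exchange_big /=; apply: eq_bigr => w' _.
by rewrite mulr_sumr.
Qed.

End Extension.
End Matrices.

(** * The trace inequality for extendible states *)

Section Bound.
Variable R : realType.
Local Notation C := (R[i]).

Lemma tensvE d (x y : 'cV[C]_d) a b : tensv x y (mxtens_index (a, b)) 0 = x a 0 * y b 0.
Proof.
have e0 : (0 : 'I_1) = mxtens_index (0 : 'I_1, 0 : 'I_1) :> 'I_(1 * 1) by apply: val_inj.
by rewrite /tensv [X in (x *t y) _ X]e0 tensmxE.
Qed.

(** The partial value of [M] on the second factor at [z]. *)
Definition slice d (M : 'M[C]_(d * d)) (z : 'I_d -> C) : 'M[C]_d :=
  \matrix_(a, a') \sum_b \sum_b'
    (z b)^* * z b' * M (mxtens_index (a, b)) (mxtens_index (a', b')).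

Lemma qform_slice d (M : 'M[C]_(d * d)) z x :
  qform (slice M z) x = qform M (tensv x (\col_b z b)).
Proof.
rewrite !qformE sum_mxtens; apply: eq_bigr => a _.
under [RHS]eq_bigr => b _ do rewrite sum_mxtens.
rewrite [RHS]exchange_big /=; apply: eq_bigr => a' _.
rewrite mxE mulr_sumr; apply: eq_bigr => b _.
rewrite mulr_sumr; apply: eq_bigr => b' _.
by rewrite !tensvE !mxE rmorphM /=; ring.
Qed.

Lemma slice_herm d (M : 'M[C]_(d * d)) z : M \is hermsymmx -> slice M z \is hermsymmx.
Proof.
move=> hM; apply: hermsymmxI => a a'; rewrite !mxE rmorph_sum exchange_big /=.
apply: eq_bigr => b _; rewrite rmorph_sum; apply: eq_bigr => b' _.
by rewrite !rmorphM /= conjCK -hermsymmxE //; ring.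
Qed.

Lemma ptraceE d l (i0 : 'I_d) (X : 'M[C]_(d * #|{: {ffun 'I_l.+1 -> 'I_d}}|)) a b a' b' :
  ptrace X (mxtens_index (a, b)) (mxtens_index (a', b')) =
  \sum_(t : l.-tuple 'I_d) word_mx i0 X a a' (b :: t) (b' :: t).
Proof.
rewrite mxE !mxtens_indexK.
pose w s := word_index l.+1 i0 s.
have sz (f : {ffun 'I_l.+1 -> 'I_d}) : size (behead (codom f)) == l.
  by rewrite size_behead size_codom card_ord.
rewrite (reindex (fun t : l.-tuple 'I_d => (w (b :: t), w (b' :: t)))) /=.
  apply: eq_bigl => t; apply/forallP => i; rewrite !ffunE.
  by case: i => -[|i] hi /=; rewrite !eqxx.
exists (fun p => Tuple (sz p.1)) => [t _|[f f']].
  by apply: val_inj; rewrite /= word_index_codom //= size_tuple.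
rewrite inE /= => /forallP h.
have e0 := h ord0; rewrite /= in e0; case/andP: e0 => /eqP f0 /eqP f0'.
have hb : b :: behead (codom f) = codom f.
  apply: (@eq_from_nth _ i0); first by rewrite /= size_behead size_codom card_ord.
  rewrite /= (eqP (sz f)) => -[|i] il /=.
    by rewrite -f0 codomE (nth_map ord0) ?size_enum_ord // (nth_ord_enum ord0 ord0).
  by rewrite nth_behead.
congr (_, _); first by rewrite /w hb codom_word_index.
apply/ffunP => i; rewrite ffunE; have := h i.
case: i => -[|i] hi /=; first by move=> /andP[_ /eqP <-]; congr (f' _); apply: val_inj.
move=> /eqP <-; rewrite nth_behead codomE.
by rewrite (nth_map ord0) ?size_enum_ord //; congr (f _); apply: val_inj; rewrite /= nth_enum_ord.
Qed.

Definition marginal d (rho : 'M[C]_(d * d)) : 'M[C]_d :=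
  \matrix_(a, a') \sum_b rho (mxtens_index (a, b)) (mxtens_index (a', b)).

(** The partial trace is the sum of the slices at the basis vectors. *)
Lemma marginal_ge0 d (rho : 'M[C]_(d * d)) : psd rho -> forall x, 0 <= qform (marginal rho) x.
Proof.
move=> [_ hr] x.
suff -> : qform (marginal rho) x =
   \sum_b qform rho (tensv x (\col_b' (b' == b)%:R)) by apply: sumr_ge0.
under [RHS]eq_bigr => b _ do rewrite -(@qform_slice _ _ (fun b' => (b' == b)%:R)) qformE.
rewrite qformE exchange_big /= [RHS]exchange_big /= exchange_big.
apply: eq_bigr => a _; rewrite [RHS]exchange_big; apply: eq_bigr => a' _ /=.
rewrite -mulr_sumr; congr (_ * _); rewrite mxE; apply: eq_bigr => b _.
rewrite mxE (bigD1 b) //= (bigD1 b) //= eqxx rmorph1 !mul1r.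
rewrite [X in _ + X + _]big1 => [|b' /negPf ->]; last by rewrite mulr0 mul0r.
rewrite big1 ?addr0 // => b' /negPf ->.
by rewrite big1 // => b'' _; rewrite rmorph0 !mul0r.
Qed.

Section Fixed.
Variables (d N e : nat) (i0 : 'I_d) (c : nat -> C).
Hypothesis N0 : (0 < N)%N.
Hypothesis c_real : forall k, (c k)^* = c k.
Local Notation l := (N + (N + e))%N.

Definition coef_state : C := \sum_(k < N.+1) \sum_(k' < N.+1) c k * c k' *
  ((N + N + d)`!%:R / (k' + k + d)`!%:R * (k' + k)`!%:R * (k' + k)%:R).
Definition coef_marginal : C := \sum_(k < N.+1) \sum_(k' < N.+1) c k * c k' *
  ((N + N + d)`!%:R / (k' + k + d)`!%:R * (k' + k)`!%:R).

(** The Gaussian average of [Tr A(z) (h |z|^2 - M_z)], a nonnegative quantity,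
    equals [h (a + d b) - a Tr (M rho) - b Tr (M (rho_A (x) 1))], and the last
    trace is nonnegative by block positivity. *)
Lemma dps_trace_bound (rho M : 'M[C]_(d * d)) (h : C) :
  DPS l rho -> M \is hermsymmx -> block_positive M -> 0 <= coef_marginal ->
  (forall (x : 'cV[C]_d) z, qform M (tensv x (\col_b z b)) <=
     h * (sqnorm (fun a => x a 0) * sqnorm z)) ->
  coef_state * \tr (M *m rho) <= h * (coef_state + d%:R * coef_marginal).
Proof.
move=> [rho_psd tr_rho [X [X_psd Xrho [P hP hX] Xpt]]] hM Mbp B0 hh.
have [Xherm _] := X_psd.
have rhoE a b a' b' : rho (mxtens_index (a, b)) (mxtens_index (a', b')) =
    \sum_(t : l.-1.-tuple 'I_d) word_mx i0 X a a' (b :: t) (b' :: t).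
  rewrite -Xrho; case: (N) N0 X {X_psd Xrho P hP hX Xpt Xherm} => // n _ X.
  exact: (ptraceE i0).
have rhoAE a a' : marginal rho a a' = \sum_(t : l.-tuple 'I_d) word_mx i0 X a a' t t.
  rewrite mxE; under eq_bigr do rewrite rhoE.
  rewrite -(sum_tupleS _ (fun s => word_mx i0 X a a' s s)).
  apply: (sum_tuple_dim (fun s => word_mx i0 X a a' s s)).
  by rewrite prednK // addn_gt0 N0.
have [Q [W [Z [W0 hW]]]] := gaussian_average 'I_d C (N + N).+1.
have avg a a' b b' : \sum_p W p * (pairing N e c (Z p) (word_mx i0 X a a') *
     ((Z p b)^* * Z p b')) =
   coef_state * rho (mxtens_index (a, b')) (mxtens_index (a', b)) +
   coef_marginal * ((b == b')%:R * marginal rho a a').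
  rewrite pairing_average //; last first.
  - by move=> t; apply: (word_mx_perml i0 hP hX).
  - by move=> s; apply: (word_mx_permr i0 hP hX Xherm).
  rewrite -rhoAE -rhoE card_ord /coef_state /coef_marginal !mulr_suml -big_split /=.
  apply: eq_bigr => k _; rewrite !mulr_suml -big_split /=.
  by apply: eq_bigr => k' _; ring.
have tr1 : \sum_a \sum_b rho (mxtens_index (a, b)) (mxtens_index (a, b)) = 1.
  by rewrite -tr_rho /mxtrace sum_mxtens.
have trA : \sum_a marginal rho a a = 1.
  by rewrite -tr1; apply: eq_bigr => a _; rewrite mxE.
(* [A(z)] and [B p] are positive at each node [z = Z p]. *)
pose B p : 'M[C]_d := (h * sqnorm (Z p))%:M - slice M (Z p).
have Bpsd p : psd (B p).
  have h0 : 0 <= h.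
    have := hh (\col_a (a == i0)%:R) (fun b => (b == i0)%:R).
    (* Testing [hh] on a unit basis vector shows that [h] is nonnegative. *)
    have s1 : sqnorm (fun b : 'I_d => (b == i0)%:R : C) = 1.
      rewrite /sqnorm (bigD1 i0) //= eqxx rmorph1 mulr1 big1 ?addr0 //.
      by move=> b /negPf ->; rewrite mulr0.
    have -> : sqnorm (fun a => (\col_a' (a' == i0)%:R : 'cV[C]_d) a 0) = 1.
      by rewrite -[RHS]s1; apply: eq_bigr => b _; rewrite mxE.
    rewrite s1 !mulr1; apply: le_trans; exact: Mbp.
  have hs0 : 0 <= h * sqnorm (Z p) by rewrite mulr_ge0 ?sqnorm_ge0.
  split.
    apply: hermsymmxI => a a'.
    have BE a1 a2 : B p a1 a2 = (h * sqnorm (Z p)) *+ (a1 == a2) - slice M (Z p) a1 a2.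
      by rewrite /B mxE [X in X + _]mxE [X in _ + X]mxE.
    rewrite !BE rmorphB rmorphMn /= [(h * _)^*]conj_Creal ?ger0_real //.
    by rewrite -(hermsymmxE (slice_herm (Z p) hM)) eq_sym.
  move=> x.
  have -> : qform (B p) x = h * (sqnorm (fun a => x a 0) * sqnorm (Z p)) - qform (slice M (Z p)) x.
    rewrite /qform mulmxBr mulmxBl mxE; congr (_ + _); last by rewrite mxE.
    rewrite mul_mx_scalar -scalemxAl mxE mulrCA mulrC; congr (_ * _).
    by rewrite mxE; apply: eq_bigr => a _; rewrite !mxE.
  by rewrite qform_slice subr_ge0.
have S0 : 0 <= \sum_p W p * \tr (pairing_mx i0 X c (Z p) *m B p).
  apply: sumr_ge0 => p _; rewrite mulr_ge0 //; apply: trace_mul_ge0 (Bpsd p).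
  by apply: pairing_mx_ge0 => //; apply: Xpt; rewrite N0 leq_addr.
have m0 : 0 <= \sum_b \tr (marginal rho *m slice M (fun b' => (b' == b)%:R)).
  apply: sumr_ge0 => b _; apply: trace_mul_ge0; first exact: marginal_ge0.
  split; first exact: slice_herm.
  by move=> x; rewrite qform_slice; apply: Mbp.
have SE : \sum_p W p * \tr (pairing_mx i0 X c (Z p) *m B p) =
   h * (coef_state + d%:R * coef_marginal) - coef_state * \tr (M *m rho)
   - coef_marginal * \sum_b \tr (marginal rho *m slice M (fun b' => (b' == b)%:R)).
  pose ent a b a' b' := M (mxtens_index (a, b)) (mxtens_index (a', b')).
  transitivity (h * (\sum_a \sum_b (coef_state * rho (mxtens_index (a, b)) (mxtens_index (a, b)) +
        coef_marginal * ((b == b)%:R * marginal rho a a))) -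
      \sum_a \sum_a' \sum_b \sum_b' (coef_state * rho (mxtens_index (a, b')) (mxtens_index (a', b)) +
        coef_marginal * ((b == b')%:R * marginal rho a a')) * ent a' b a b').
    under [in RHS]eq_bigr => a _ do under eq_bigr => b _ do rewrite -avg.
    under [X in _ = _ - X]eq_bigr => a _ do under eq_bigr => a' _ do under eq_bigr => b _ do
      under eq_bigr => b' _ do rewrite -avg mulr_suml.
    under [in RHS]eq_bigr => a _ do rewrite exchange_big /=.
    rewrite [in RHS]exchange_big mulr_sumr /=.
    under [X in _ = _ - X]eq_bigr => a _ do under eq_bigr => a' _ do under eq_bigr => b _ do
      rewrite exchange_big /=.
    under [X in _ = _ - X]eq_bigr => a _ do under eq_bigr => a' _ do rewrite exchange_big /=.
    under [X in _ = _ - X]eq_bigr => a _ do rewrite exchange_big /=.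
    rewrite [X in _ = _ - X]exchange_big /= -sumrB; apply: eq_bigr => p _.
    have BE a1 a2 : B p a1 a2 = (h * sqnorm (Z p)) *+ (a1 == a2) - slice M (Z p) a1 a2.
      by rewrite /B mxE [X in X + _]mxE [X in _ + X]mxE.
    transitivity (W p * (\sum_a pairing N e c (Z p) (word_mx i0 X a a) * (h * sqnorm (Z p)) -
       \sum_a \sum_a' pairing N e c (Z p) (word_mx i0 X a a') * slice M (Z p) a' a)).
      rewrite -sumrB; congr (_ * _); apply: eq_bigr => a _; rewrite mxE.
      under eq_bigr => a' _ do rewrite BE mxE mulrBr.
      rewrite sumrB; congr (_ - _); rewrite (bigD1 a) //= eqxx mulr1n big1 ?addr0 //.
      by move=> a' /negPf ->; rewrite mulr0n mulr0.
    rewrite mulrBr; congr (_ - _).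
      rewrite !mulr_sumr; apply: eq_bigr => a _; rewrite mulr_sumr /sqnorm !mulr_sumr.
      by apply: eq_bigr => b _; ring.
    rewrite mulr_sumr; apply: eq_bigr => a _; rewrite mulr_sumr; apply: eq_bigr => a' _.
    rewrite mxE !mulr_sumr; apply: eq_bigr => b _; rewrite !mulr_sumr; apply: eq_bigr => b' _.
    by rewrite /ent; ring.
  rewrite -addrA -opprD; congr (_ - _).
    congr (_ * _); under eq_bigr => a _ do rewrite big_split /= -mulr_sumr.
    rewrite big_split /= -mulr_sumr tr1 mulr1; congr (_ + _).
    under eq_bigr => a _ do under eq_bigr => b _ do rewrite eqxx mul1r.
    under eq_bigr => a _ do rewrite sumr_const card_ord -mulr_natl.
    by rewrite -mulr_sumr -mulr_sumr trA mulr1.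
  transitivity (\sum_a \sum_a' \sum_b \sum_b' coef_state * (ent a' b a b' *
        rho (mxtens_index (a, b')) (mxtens_index (a', b))) +
     \sum_a \sum_a' \sum_b coef_marginal * (marginal rho a a' * ent a' b a b)).
    rewrite -big_split; apply: eq_bigr => a _; rewrite -big_split; apply: eq_bigr => a' _.
    rewrite -big_split; apply: eq_bigr => b _ /=.
    under eq_bigr => b' _ do rewrite mulrDl.
    rewrite big_split; congr (_ + _); first by apply: eq_bigr => b' _; rewrite -mulrA [rho _ _ * _]mulrC.
    rewrite (bigD1 b) //= eqxx mul1r big1 ?addr0 ?mulrA // => b' /negPf bb'.
    by rewrite [b == b']eq_sym bb' mul0r mulr0 mul0r.
  congr (_ + _).
    rewrite /mxtrace sum_mxtens mulr_sumr exchange_big /=; apply: eq_bigr => a' _.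
    under [in RHS]eq_bigr => b _ do rewrite mxE sum_mxtens.
    rewrite mulr_sumr [LHS]exchange_big /=; apply: eq_bigr => b _.
    rewrite mulr_sumr; apply: eq_bigr => a _; rewrite mulr_sumr; by apply: eq_bigr.
  rewrite mulr_sumr.
  transitivity (\sum_b \sum_a \sum_a' coef_marginal * (marginal rho a a' * ent a' b a b)).
    by rewrite [RHS]exchange_big; apply: eq_bigr => a _; rewrite [RHS]exchange_big.
  apply: eq_bigr => b _; rewrite /mxtrace mulr_sumr; apply: eq_bigr => a _.
  rewrite mxE mulr_sumr; apply: eq_bigr => a' _; congr (_ * (_ * _)).
  rewrite mxE (bigD1 b) //= (bigD1 b) //= eqxx rmorph1 !mul1r.
  rewrite [X in _ + X + _]big1 => [|b' /negPf ->]; last by rewrite mulr0 mul0r.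
  rewrite big1 ?addr0 // => b' /negPf ->.
  by rewrite big1 // => b'' _; rewrite rmorph0 !mul0r.
have : 0 <= h * (coef_state + d%:R * coef_marginal) - coef_state * \tr (M *m rho).
  have := mulr_ge0 B0 m0; move: S0; rewrite SE => S0 m0'.
  by apply: le_trans S0 _; rewrite gerDl oppr_le0.
by rewrite subr_ge0.
Qed.

End Fixed.
End Bound.

(** * Separable states *)

Section Separable.
Variable R : realType.
Local Notation C := (R[i]).

Lemma psd_rank1 n (v : 'cV[C]_n) : psd (v *m v^t*).
Proof.
split; first by apply: hermsymmxI => i j; rewrite !mxE !big_ord1 !mxE rmorphM /= conjCK mulrC.
move=> w; rewrite /qform !mulmxA -mulmxA mxE big_ord1.
have -> : (v^t* *m w) 0 0 = ((w^t* *m v) 0 0)^*.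
  rewrite !mxE rmorph_sum; apply: eq_bigr => i _.
  by rewrite !mxE rmorphM /= conjCK mulrC.
exact: mul_conjC_ge0.
Qed.

Lemma psd_sum n k (p : 'I_k -> R) (B : 'I_k -> 'M[C]_n) :
  (forall i, 0 <= p i) -> (forall i, psd (B i)) -> psd (\sum_i (p i)%:C%C *: B i).
Proof.
move=> p0 hB; split.
  apply: hermsymmxI => i j; rewrite !summxE rmorph_sum; apply: eq_bigr => t _.
  rewrite !mxE rmorphM /= -(hermsymmxE (hB t).1) [X in _ = X * _]conj_Creal //.
  by rewrite ger0_real // lecR.
move=> v.
have -> : qform (\sum_i (p i)%:C%C *: B i) v = \sum_i (p i)%:C%C * qform (B i) v.
  rewrite /qform mulmx_sumr mulmx_suml summxE; apply: eq_bigr => i _.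
  by rewrite -scalemxAr -scalemxAl mxE.
by apply: sumr_ge0 => i _; rewrite mulr_ge0 ?(hB i).2 // lecR.
Qed.

Lemma norm2_eq1 n (x : 'cV[C]_n) : norm2 x = 1 -> sqnorm (fun a => x a 0) = 1.
Proof.
move=> /(congr1 (fun t => t ^+ 2)); rewrite /norm2 sqrtCK expr1n => <-.
by apply: eq_bigr => i _; rewrite normCK mulrC.
Qed.

Lemma tr_mul_rank1 n (M : 'M[C]_n) v : \tr (M *m (v *m v^t*)) = qform M v.
Proof. by rewrite mulmxA mxtrace_mulC mulmxA /mxtrace big_ord1. Qed.

Lemma tens_rank1 d (x y : 'cV[C]_d) :
  (x *m x^t*) *t (y *m y^t*) = tensv x y *m (tensv x y)^t*.
Proof.
have e : (x *t y) *m (x *t y)^t* = (x *m x^t*) *t (y *m y^t*).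
  by rewrite trmx_tens map_mxT tensmx_mul.
by rewrite -e.
Qed.

Section Product.
Variables (d l : nat) (i0 : 'I_d) (x y : 'cV[C]_d).
Local Notation idx := {ffun 'I_l.+1 -> 'I_d}.
Local Notation dimB := #|{: idx}|.

Definition prodv : 'cV[C]_(d * dimB) :=
  \col_k (x (ix_fst k) 0 * \prod_j y (ix_snd k j) 0).

Lemma prodvE a f : prodv (ix a f) 0 = x a 0 * \prod_j y (f j) 0.
Proof. by rewrite mxE /ix_fst /ix_snd mxtens_indexK /= enum_rankK. Qed.

Lemma prodv_word a s : size s = l.+1 ->
  prodv (ix a (word_index l.+1 i0 s)) 0 = x a 0 * mono (fun b => y b 0) s.
Proof.
move=> ss; rewrite prodvE /mono (big_nth i0) big_mkord ss; congr (_ * _).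
by apply: eq_bigr => j _; rewrite ffunE.
Qed.

(** Permuting the factors of [y (x) ... (x) y] changes nothing. *)
Lemma prodv_sym P : orthoprojector (@sym_subspace R d l.+1) P -> (1%:M *t P) *m prodv = prodv.
Proof.
move=> [_ _ PV]; apply/matrixP => k t; rewrite (ord1 t).
case: (mxtens_indexP k) => a b.
pose v : 'cV[C]_dimB := \col_k prodv (mxtens_index (a, k)) 0.
have : sym_subspace v.
  move=> s; apply/matrixP => j t'; rewrite !mxE /ix_fst /ix_snd !mxtens_indexK /= !enum_rankK.
  congr (_ * _); rewrite [RHS](reindex_inj (@perm_inj _ s)) /=.
  by apply: eq_bigr => i _; rewrite ffunE.
move=> /PV /matrixP /(_ b 0).
have -> : v b 0 = prodv (mxtens_index (a, b)) 0 by rewrite mxE.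
move=> <-; rewrite [LHS]mxE sum_mxtens (bigD1 a) //= [X in _ + X]big1 ?addr0.
  rewrite [RHS]mxE; apply: eq_bigr => k' _.
  by rewrite tensmxE [(1%:M) a a]mxE eqxx mul1r [v _ _]mxE.
move=> b' /negPf ba; apply: big1 => k' _.
by rewrite tensmxE [(1%:M) a b']mxE eq_sym ba !mul0r.
Qed.

Lemma sum_mono_sqr m (z : 'I_d -> C) :
  \sum_(t : m.-tuple 'I_d) mono z t * (mono z t)^* = sqnorm z ^+ m.
Proof.
elim: m => [|m IH].
  by rewrite (sum_tuple0 (fun t => mono z t * (mono z t)^*)) /mono big_nil mul1r rmorph1.
rewrite (sum_tupleS _ (fun t => mono z t * (mono z t)^*)) exprS -IH /sqnorm mulr_suml.
apply: eq_bigr => c _; rewrite mulr_sumr; apply: eq_bigr => t _.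
by rewrite /mono !big_cons rmorphM /=; ring.
Qed.

Lemma ptrace_prodv : sqnorm (fun b => y b 0) = 1 ->
  ptrace (prodv *m prodv^t*) = (x *m x^t*) *t (y *m y^t*).
Proof.
move=> y1; apply/matrixP => k k'.
case: (mxtens_indexP k) => a b; case: (mxtens_indexP k') => a' b'.
rewrite (ptraceE i0) tensmxE.
transitivity (x a 0 * y b 0 * (x a' 0 * y b' 0)^* *
   \sum_(t : l.-tuple 'I_d) mono (fun b => y b 0) t * (mono (fun b => y b 0) t)^*).
  rewrite mulr_sumr; apply: eq_bigr => t _.
  rewrite /word_mx mxE big_ord1 [(_^t*) _ _]mxE [(_^T) _ _]mxE.
  rewrite !prodv_word ?size_tuple //= ?size_tuple //.
  by rewrite /mono !big_cons !rmorphM /=; ring.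
rewrite sum_mono_sqr y1 expr1n mulr1 !mxE !big_ord1 !mxE rmorphM /=; ring.
Qed.

(** The partial transpose of [|y><y|] on a factor is the projection on the
    conjugate of [y]. *)
Lemma ptranspose_prodv s : psd (ptranspose s (prodv *m prodv^t*)).
Proof.
pose w : 'cV[C]_(d * dimB) := \col_k (x (ix_fst k) 0 *
  \prod_(j < l.+1) (if (j < s)%N then (y (ix_snd k j) 0)^* else y (ix_snd k j) 0)).
suff -> : ptranspose s (prodv *m prodv^t*) = w *m w^t* by apply: psd_rank1.
apply/matrixP => k k'; rewrite mxE [LHS]mxE [RHS]mxE !big_ord1.
rewrite [(prodv^t*) _ _]mxE [(prodv^T) _ _]mxE [(w^t*) _ _]mxE [(w^T) _ _]mxE.
rewrite !prodvE ![w _ _]mxE !rmorphM /= !rmorph_prod mulrACA [RHS]mulrACA.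
congr (_ * _); rewrite -!big_split /=; apply: eq_bigr => j _.
by rewrite !ffunE; case: ifP => _ //=; rewrite conjCK mulrC.
Qed.

End Product.

Lemma Sep_sub_DPS d l (rho : 'M[C]_(d * d)) (i0 : 'I_d) : Sep rho -> DPS l.+1 rho.
Proof.
case=> k [p [B [p0 p1 hB ->]]].
have /choice[x /choice[y hxy]] : forall i, exists x y, [/\ norm2 x = 1, norm2 y = 1
  & B i = (x *m x^t*) *t (y *m y^t*)] by move=> i; apply: hB.
have BE i : B i = tensv (x i) (y i) *m (tensv (x i) (y i))^t*.
  by rewrite -tens_rank1; case: (hxy i).
have x1 i : sqnorm (fun a => x i a 0) = 1 by case: (hxy i) => /norm2_eq1.
have y1 i : sqnorm (fun a => y i a 0) = 1 by case: (hxy i) => _ /norm2_eq1.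
split.
- by apply: psd_sum => // i; rewrite BE; apply: psd_rank1.
- rewrite raddf_sum /=; transitivity (\sum_i (p i)%:C%C : C).
    apply: eq_bigr => i _; rewrite mxtraceZ.
    suff -> : \tr (B i) = 1 by rewrite mulr1.
    rewrite BE /mxtrace sum_mxtens -[RHS](mulr1 1) -{1}(x1 i) -{1}(y1 i).
    rewrite /sqnorm mulr_suml; apply: eq_bigr => a _; rewrite mulr_sumr; apply: eq_bigr => b _.
    by rewrite mxE big_ord1 [(_^t*) _ _]mxE [(_^T) _ _]mxE !tensvE rmorphM /=; ring.
  by rewrite -rmorph_sum p1 rmorph1.
pose Y i := prodv l (x i) (y i) *m (prodv l (x i) (y i))^t*.
have [P hP] := sym_orthoprojector_ex R d l.+1.
exists (\sum_i (p i)%:C%C *: Y i); split.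
- by apply: psd_sum => // i; apply: psd_rank1.
- apply/matrixP => j j'; rewrite [RHS]summxE.
  case: (mxtens_indexP j) => a b; case: (mxtens_indexP j') => a' b'.
  transitivity (\sum_i (p i)%:C%C * ptrace (Y i) (mxtens_index (a, b)) (mxtens_index (a', b'))).
    rewrite (ptraceE i0).
    under [RHS]eq_bigr => i _ do rewrite (ptraceE i0) mulr_sumr.
    rewrite exchange_big; apply: eq_bigr => t _.
    by rewrite /word_mx summxE; apply: eq_bigr => i _; rewrite [LHS]mxE.
  apply: eq_bigr => i _; rewrite [RHS]mxE; congr (_ * _).
  by rewrite /Y (ptrace_prodv l i0) //; case: (hxy i) => _ _ ->.
- exists P => //; rewrite mulmx_sumr mulmx_suml; apply: eq_bigr => i _.
  rewrite -scalemxAr -scalemxAl; congr (_ *: _).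
  have e := prodv_sym (x i) (y i) hP.
  rewrite /Y mulmxA e -mulmxA; congr (_ *m _).
  rewrite -[in RHS]e trmx_mul map_mxM; congr (_ *m _).
  by rewrite trmx_tens map_mxT trmx1 map_mx1; case: hP => _ -> _.
- move=> s _; suff -> : ptranspose s (\sum_i (p i)%:C%C *: Y i) =
     \sum_i (p i)%:C%C *: ptranspose s (Y i).
    by apply: psd_sum => // i; apply: ptranspose_prodv.
  apply/matrixP => j j'; rewrite mxE !summxE; apply: eq_bigr => i _.
  by rewrite [LHS]mxE [RHS]mxE; congr (_ * _); rewrite [RHS]mxE.
Qed.

End Separable.

Section Final.
Variable R : realType.
Local Notation C := (R[i]).

Lemma Re_ge0 (z : C) : 0 <= z -> z = (complex.Re z)%:C%C /\ 0 <= complex.Re z.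
Proof. by case: z => a b; rewrite lecE /= => /andP[/eqP -> ->]. Qed.

Lemma Re_realM (r : R) (z : C) : complex.Re (r%:C%C * z) = r * complex.Re z.
Proof. by case: z => a b /=; rewrite mul0r subr0. Qed.

Lemma Re_sum k (F : 'I_k -> C) : complex.Re (\sum_i F i) = \sum_i complex.Re (F i).
Proof. by apply: (big_morph (@complex.Re R)) => // -[a b] [a' b']. Qed.

Lemma norm_entry_le1 n (v : 'cV[C]_n) i : sqnorm (fun a => v a 0) = 1 -> `|v i 0| <= 1.
Proof.
move=> v1; rewrite -(@ler_pXn2r _ 2) ?nnegrE // expr1n -v1 normCK mulrC /sqnorm.
by rewrite (bigD1 i) //= lerDl sumr_ge0 // => j _; rewrite mulrC mul_conjC_ge0.
Qed.

Lemma sqnorm_tensv d (x y : 'cV[C]_d) :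
  sqnorm (fun k => tensv x y k 0) = sqnorm (fun a => x a 0) * sqnorm (fun b => y b 0).
Proof.
rewrite /sqnorm sum_mxtens mulr_suml; apply: eq_bigr => a _; rewrite mulr_sumr.
by apply: eq_bigr => b _; rewrite tensvE rmorphM /=; ring.
Qed.

Lemma qform_norm_le n (M : 'M[C]_n) (v : 'cV[C]_n) : sqnorm (fun a => v a 0) = 1 ->
  `|qform M v| <= \sum_i \sum_j `|M i j|.
Proof.
move=> v1; rewrite qformE (le_trans (ler_norm_sum _ _ _)) //; apply: ler_sum => i _.
rewrite (le_trans (ler_norm_sum _ _ _)) //; apply: ler_sum => j _.
rewrite !normrM norm_conjC ler_piMl // mulr_ile1 //; exact: norm_entry_le1.
Qed.

Section Fixed.
Variables (d : nat) (i0 : 'I_d) (M : 'M[C]_(d * d)).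
Hypothesis Mbp : block_positive M.

Lemma Sep_trace (rho : 'M[C]_(d * d)) (K : R) : 0 <= K ->
  (forall x y : 'cV[C]_d, sqnorm (fun a => x a 0) = 1 -> sqnorm (fun a => y a 0) = 1 ->
    complex.Re (qform M (tensv x y)) <= K) ->
  Sep rho -> 0 <= complex.Re (\tr (M *m rho)) <= K.
Proof.
move=> K0 hK [k [p [B [p0 p1 hB ->]]]].
have -> : complex.Re (\tr (M *m \sum_i (p i)%:C%C *: B i)) =
    \sum_i p i * complex.Re (\tr (M *m B i)).
  rewrite mulmx_sumr [\tr _]raddf_sum /= Re_sum; apply: eq_bigr => i _.
  by rewrite -scalemxAr mxtraceZ Re_realM.
have h i : 0 <= complex.Re (\tr (M *m B i)) <= K.
  have [x [y [x1 y1 ->]]] := hB i.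
  rewrite tens_rank1 tr_mul_rank1 hK ?norm2_eq1 // andbT.
  by case: (Re_ge0 (Mbp x y)).
rewrite sumr_ge0 /= => [|i _]; last by rewrite mulr_ge0 //; case/andP: (h i).
rewrite -[K]mul1r -p1 mulr_suml; apply: ler_sum => i _.
by rewrite ler_wpM2l //; case/andP: (h i).
Qed.

Lemma product_state_Sep (x y : 'cV[C]_d) : norm2 x = 1 -> norm2 y = 1 ->
  Sep ((x *m x^t*) *t (y *m y^t*)).
Proof.
move=> x1 y1; exists 1%N, (fun=> 1), (fun=> (x *m x^t*) *t (y *m y^t*)).
by split=> //; rewrite ?big_ord1 ?scale1r // => _; exists x, y.
Qed.

Lemma Sep_nonempty : exists rho : 'M[C]_(d * d), Sep rho.
Proof.
pose x : 'cV[C]_d := \col_a (a == i0)%:R.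
have x1 : norm2 x = 1.
  rewrite /norm2 (bigD1 i0) //= mxE eqxx normr1 expr1n big1 ?addr0 ?sqrtC1 //.
  by move=> a /negPf ai; rewrite mxE ai normr0 expr0n.
by exists ((x *m x^t*) *t (x *m x^t*)); apply: product_state_Sep.
Qed.

(** A crude bound; it makes the supremum over [Sep] a genuine one. *)
Lemma Sep_trace_bounds rho : Sep rho ->
  0 <= complex.Re (\tr (M *m rho)) <= complex.Re (\sum_i \sum_j `|M i j|).
Proof.
have S0 : (0 : C) <= \sum_i \sum_j `|M i j|.
  by apply: sumr_ge0 => i _; apply: sumr_ge0.
have [_ K0] := Re_ge0 S0.
apply: Sep_trace => // x y x1 y1.
have := @qform_norm_le _ M (tensv x y); rewrite sqnorm_tensv x1 y1 mulr1 => /(_ erefl).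
by rewrite ger0_norm ?Mbp // lecE => /andP[].
Qed.

Lemma Sep_ubound : has_ubound [set complex.Re (\tr (M *m rho)) | rho in @Sep R d].
Proof.
exists (complex.Re (\sum_i \sum_j `|M i j|)) => _ [rho hrho <-].
by case/andP: (Sep_trace_bounds hrho).
Qed.

Lemma Sep_le_hSep rho : Sep rho -> complex.Re (\tr (M *m rho)) <= hSep M.
Proof. by move=> hr; apply: ub_le_sup; [exact: Sep_ubound | exists rho]. Qed.

Lemma hSep_ge0 : 0 <= hSep M.
Proof.
have [rho hrho] := Sep_nonempty.
apply: le_trans (Sep_le_hSep hrho).
by case/andP: (Sep_trace_bounds hrho).
Qed.

Lemma qform_scale_tensv a b (x y : 'cV[C]_d) :
  qform M (tensv (a *: x) (b *: y)) = `|a| ^+ 2 * `|b| ^+ 2 * qform M (tensv x y).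
Proof.
rewrite !qformE mulr_sumr; apply: eq_bigr => k _; rewrite mulr_sumr; apply: eq_bigr => k' _.
case: (mxtens_indexP k) => i j; case: (mxtens_indexP k') => i' j'.
by rewrite !tensvE !mxE !rmorphM /= !normCK; ring.
Qed.

Lemma sqnorm_eq0 n (x : 'cV[C]_n) : sqnorm (fun a => x a 0) = 0 -> x = 0.
Proof.
move=> /eqP; rewrite psumr_eq0 => [/allP h|a _]; last by rewrite mulrC mul_conjC_ge0.
apply/matrixP => a t; rewrite (ord1 t) mxE; apply/eqP.
have /implyP/(_ isT) := h a (mem_index_enum _).
by rewrite mulrC mul_conjC_eq0.
Qed.

Lemma norm2_normalize n (x : 'cV[C]_n) : sqnorm (fun a => x a 0) != 0 ->
  norm2 ((sqrtC (sqnorm (fun a => x a 0)))^-1 *: x) = 1.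
Proof.
move=> s0; rewrite /norm2; set s := sqnorm _ in s0 *.
have r0 : 0 <= sqrtC s by rewrite sqrtC_ge0 sqnorm_ge0.
transitivity (sqrtC (s^-1 * s)); last by rewrite mulVf // sqrtC1.
congr sqrtC; rewrite {2}/s /sqnorm mulr_sumr; apply: eq_bigr => i _.
by rewrite mxE normrM exprMn normfV (ger0_norm r0) exprVn sqrtCK normCK [x i 0 * _]mulrC.
Qed.

(** Homogeneity, from product states to all product vectors. *)
Lemma qform_le_hSep (x y : 'cV[C]_d) :
  qform M (tensv x y) <= (hSep M)%:C%C * (sqnorm (fun a => x a 0) * sqnorm (fun a => y a 0)).
Proof.
set s := sqnorm _; set t := sqnorm _.
have q0 : tensv x y = 0 -> qform M (tensv x y) = 0.
  by move=> ->; rewrite /qform mulmx0 mxE.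
have [s0|s0] := eqVneq s 0.
  rewrite s0 mul0r mulr0 q0 //; apply/matrixP => k j; rewrite (ord1 j).
  by case: (mxtens_indexP k) => a b; rewrite tensvE (sqnorm_eq0 s0) !mxE mul0r.
have [t0|t0] := eqVneq t 0.
  rewrite t0 !mulr0 q0 //; apply/matrixP => k j; rewrite (ord1 j).
  by case: (mxtens_indexP k) => a b; rewrite tensvE (sqnorm_eq0 t0) !mxE mulr0.
have sp : 0 < s by rewrite lt0r s0 sqnorm_ge0.
have tp : 0 < t by rewrite lt0r t0 sqnorm_ge0.
have := Sep_le_hSep (product_state_Sep (norm2_normalize s0) (norm2_normalize t0)).
rewrite tens_rank1 tr_mul_rank1 qform_scale_tensv -/s -/t.
have nE (u : C) : 0 < u -> `|(sqrtC u)^-1| ^+ 2 = u^-1.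
  by move=> u0; rewrite normfV exprVn ger0_norm ?sqrtCK // sqrtC_ge0 ltW.
rewrite !nE //.
have z0 : 0 <= s^-1 * t^-1 * qform M (tensv x y).
  by rewrite !mulr_ge0 ?invr_ge0 ?Mbp // ltW.
have [zE _] := Re_ge0 z0; move=> h.
have : s^-1 * t^-1 * qform M (tensv x y) <= (hSep M)%:C%C by rewrite zE lecR.
by rewrite -invfM mulrC ler_pdivrMr ?mulr_gt0.
Qed.

End Fixed.
End Final.

(** * The convergence rate *)

Section Main.
Variable R : realType.
Local Notation C := (R[i]).

Section Coefficients.
Variables (g N : nat) (q : {poly R}).
Hypothesis sq : (size q <= N.+1)%N.
Let K : R := (N + N + g.+1)`!%:R / g`!%:R.
Let c k : C := (q`_k)%:C%C.

Lemma coef_marginalE : coef_marginal g.+1 N c = (K * mom (nu_moment R g) (q ^+ 2))%:C%C.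
Proof.
rewrite (mom_sqr _ sq) mulr_sumr rmorph_sum /coef_marginal; apply: eq_bigr => k _.
rewrite mulr_sumr rmorph_sum; apply: eq_bigr => k' _.
rewrite -!(rmorph_nat (real_complex R)) -fmorphV -!rmorphM; congr (_%:C%C).
by rewrite /K /nu_moment -addnS; field; rewrite !fact_neq0.
Qed.

(** The factor [k' + k] that [coef_state] has in addition turns [nu_m] into
    [mu_m - d nu_m], by [mu_nu]. *)
Lemma coef_stateE : coef_state g.+1 N c =
  (K * (mom (mu_moment R g) (q ^+ 2) - g.+1%:R * mom (nu_moment R g) (q ^+ 2)))%:C%C.
Proof.
rewrite !(mom_sqr _ sq) !mulr_sumr -sumrB mulr_sumr rmorph_sum /coef_state.
apply: eq_bigr => k _; rewrite mulr_sumr -sumrB mulr_sumr rmorph_sum.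
apply: eq_bigr => k' _.
rewrite -!(rmorph_nat (real_complex R)) -fmorphV -!rmorphM; congr (_%:C%C).
rewrite mu_nu natrD /K /nu_moment -addnS; field.
by rewrite !fact_neq0.
Qed.

Lemma coef_scale_gt0 : 0 < K.
Proof. by rewrite divr_gt0 // ltr0n fact_gt0. Qed.

End Coefficients.

(** With [S = N (N + 1) / 2 >= l^2 / 16], the bounds give
    [d nu / mu <= d^2 / (2 S) <= 8 d^2 / l^2], at most one half when [4 d <= l];
    passing from [mu] to [mu - d nu] costs at most a factor two. *)
Lemma kernel_ratio (nu mu S d l : R) : 0 < d -> 4 * d <= l ->
  l ^+ 2 <= 16 * S -> nu <= S / 2 -> S ^+ 2 / d <= mu ->
  0 < mu - d * nu /\
  d * nu <= 16 * (d ^+ 2 / l ^+ 2) * (mu - d * nu).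
Proof.
move=> d0 dl lS hnu hmu.
have l0 : 0 < l by lra.
have dd : d ^+ 2 <= S by nra.
have S0 : 0 < S by nra.
have mud : S ^+ 2 <= mu * d by rewrite -ler_pdivrMr.
have dmu : d * S <= mu.
  by rewrite -(ler_pM2l d0) mulrA [d * mu]mulrC; nra.
have dnu : d * nu <= d * S / 2 by rewrite -mulrA ler_pM2l.
have pos : 0 < mu - d * nu by have := mulr_gt0 d0 S0; lra.
split=> //.
rewrite mulrA [X in _ <= X]mulrAC ler_pdivlMr ?exprn_gt0 //.
have h1 : d * nu * l ^+ 2 + 16 * d ^+ 2 * (d * nu) <= d * S * l ^+ 2.
  have h2 : 16 * d ^+ 2 <= l ^+ 2 by nra.
  have h3 : d * nu * l ^+ 2 <= d * S / 2 * l ^+ 2 by rewrite ler_pM2r ?exprn_gt0.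
  have h4 : 16 * d ^+ 2 * (d * nu) <= 16 * d ^+ 2 * (d * S / 2).
    by rewrite ler_wpM2l // mulr_ge0 // sqr_ge0.
  have h5 : 16 * d ^+ 2 * (d * S / 2) <= l ^+ 2 * (d * S / 2).
    by rewrite ler_wpM2r // mulr_ge0 ?invr_ge0 // mulr_ge0 // ltW.
  by lra.
have h6 : d * S * l ^+ 2 <= d * S * (16 * S) by rewrite ler_wpM2l // mulr_ge0 // ltW.
have h7 : d * S * (16 * S) <= 16 * d ^+ 2 * mu by nra.
by lra.
Qed.

(** [N = l / 2] is the largest degree for which the kernel fits, as its square
    uses [2 N] systems; for odd [l] one system is traced out. *)
Lemma DPS_trace_le d l (M rho : 'M[C]_(d * d)) : (1 <= d)%N -> (4 * d <= l)%N ->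
  M \is hermsymmx -> block_positive M -> DPS l rho ->
  complex.Re (\tr (M *m rho)) <= (1 + 16 * (d%:R ^+ 2 / l%:R ^+ 2)) * hSep M.
Proof.
case: d M rho => // g M rho _ dl hM Mbp hrho.
pose N := l./2; pose e := odd l.
have lE : l = (N + (N + e))%N by rewrite /N /e addnA addnn addnC odd_double_half.
have N0 : (0 < N)%N by rewrite /N; lia.
pose q := kernel_poly R g N.+1.
have sq : (size q <= N.+1)%N by apply: size_kernel_poly.
pose c k : C := (q`_k)%:C%C.
have c_real k : (c k)^* = c k by rewrite conj_Creal // complex_real.
set nu := mom (nu_moment R g) (q ^+ 2).
set mu := mom (mu_moment R g) (q ^+ 2).
have nu0 : 0 <= nu by apply: nu_kernel_sqr_ge0.
have S2 := triangleE N.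
have [|||||apos ratio] := @kernel_ratio nu mu (triangle N.+1)%:R g.+1%:R l%:R.
- by rewrite ltr0n.
- by rewrite -natrM ler_nat.
- by rewrite -natrX -natrM ler_nat; move: S2; rewrite lE /e; case: (odd l); nia.
- exact: nu_kernel_le.
- exact: mu_kernel_ge.
have K0 := coef_scale_gt0 g N.
rewrite lE in hrho.
pose K : R := (N + N + g.+1)`!%:R / g`!%:R.
have B0 : 0 <= coef_marginal g.+1 N c by rewrite (@coef_marginalE g N q sq) lecR mulr_ge0 // ltW.
have hq (x : 'cV[C]_g.+1) z : qform M (tensv x (\col_b z b)) <=
    (hSep M)%:C%C * (sqnorm (fun a => x a 0) * sqnorm z).
  have := qform_le_hSep Mbp x (\col_b z b).
  rewrite (_ : sqnorm (fun a => (\col_b z b : 'cV[C]_g.+1) a 0) = sqnorm z) //.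
  by apply: eq_bigr => b _; rewrite mxE.
have := dps_trace_bound (ord0 : 'I_g.+1) N0 c_real hrho hM Mbp B0 hq.
rewrite (@coef_marginalE g N q sq) (@coef_stateE g N q sq) -/nu -/mu -/K.
rewrite -(rmorph_nat (real_complex R)) -rmorphM -rmorphD -rmorphM lecE => /andP[_].
rewrite Re_realM /= => main.
have S0 := hSep_ge0 (ord0 : 'I_g.+1) Mbp.
set t := complex.Re _ in main *.
have a0 : 0 < K * (mu - g.+1%:R * nu) by rewrite mulr_gt0.
rewrite -(ler_pM2l a0); apply: le_trans main _.
have -> : K * (mu - g.+1%:R * nu) * ((1 + 16 * (g.+1%:R ^+ 2 / l%:R ^+ 2)) * hSep M) =
  hSep M * (K * (mu - g.+1%:R * nu) + K * (16 * (g.+1%:R ^+ 2 / l%:R ^+ 2) * (mu - g.+1%:R * nu))).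
  by ring.
rewrite ler_wpM2l // lerD2l [X in X <= _]mulrCA ler_wpM2l // ltW //.
Qed.

End Main.

Theorem theorem4 (R : realType) :
  exists C C' : R, 0 < C /\ 0 < C' /\
  forall (d : nat) (M : 'M[R[i]]_(d * d)),
    (1 <= d)%N ->
    M \is hermsymmx ->
    block_positive M ->
    forall l : nat, C' * d%:R <= l%:R ->
      hSep M <= hDPS l M /\
      hDPS l M <= (1 + C * (d%:R ^+ 2 / l%:R ^+ 2)) * hSep M.
Proof.
exists 16, 4; split; first by rewrite ltr0n.
split; first by rewrite ltr0n.
move=> d M d0 hM Mbp l; rewrite -natrM ler_nat => dl.
pose i0 : 'I_d := Ordinal d0.
case: l dl => [|l] dl; first by move: dl; rewrite leqn0 muln_eq0 /= -leqn0 leqNgt d0.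
have [rho0 hrho0] := Sep_nonempty R i0.
have bound := fun rho => @DPS_trace_le R d l.+1 M rho d0 dl hM Mbp.
split.
  apply: ge_sup; first by exists (complex.Re (\tr (M *m rho0))), rho0.
  move=> _ [rho hrho <-]; apply: ub_le_sup; last by exists rho => //; apply: Sep_sub_DPS.
  by exists ((1 + 16 * (d%:R ^+ 2 / l.+1%:R ^+ 2)) * hSep M) => _ [sg hsg <-]; apply: bound.
apply: ge_sup; last by move=> _ [rho hrho <-]; apply: bound.
by exists (complex.Re (\tr (M *m rho0))), rho0 => //; apply: Sep_sub_DPS.
Qed.
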